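(* Let $P_\lambda(n)$ be defined by $\sum_{n=0}^{\infty}P_\lambda(n)q^n=\lambda(q)$, where $\lambda(q)=\sum_{n=0}^{\infty}\dfrac{(-1)^nq^n(q;q^2)_n}{(-q;q)_n}$. Then for every integer $n\ge 0$, $$P_\lambda(6n+2)=3\sum_{l=0}^{\infty}(-1)^l(2l+1)\,\bar{p}_{3}\left(n-\dfrac{3l(l+1)}{2}\right)+6\sum_{l=0}^{\infty}\sum_{k=1}^{\infty}(-1)^{l+k}(2l+1)\,\bar{p}_{3}\left(n-3k^2-\dfrac{3l(l+1)}{2}\right).$$
   Context: Notation: $(b;q)_n=\prod_{k=0}^{n-1}(1-bq^k)$ and $\ell_k=\prod_{m\ge1}(1-q^{km})$. $\bar p_3(n)$ is the number of overpartitions of $n$ with $3$ copies (colours), with $\sum_{n\ge0}\bar p_3(n)q^n=(\ell_2/\ell_1^2)^3$. The function $\lambda(q)$ is a sixth order mock theta function. Convention: $\bar p_3(m)=0$ for $m<0$. *)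

(* Defs.v *)
From HB Require Import structures.
From mathcomp Require Import all_boot all_order all_algebra.
From mathcomp Require Import mathcomp_extra boolp classical_sets functions.
From mathcomp Require Import cardinality fsbigop filter.

Set Implicit Arguments.
Unset Strict Implicit.
Unset Printing Implicit Defensive.

Import Order.TTheory GRing.Theory Num.Theory.

Local Open Scope classical_set_scope.
Local Open Scope ring_scope.

Record fps (R : Type) := Fps { coef : nat -> R }.

Lemma fpsP (R : Type) (x y : fps R) :
  (forall n, coef x n = coef y n) <-> x = y.
Proof.
split=> [|-> //]; case: x y => [x] [y] /= xy.
by congr Fps; apply/funext.
Qed.

HB.instance Definition _ (R : Type) := gen_eqMixin (fps R).
HB.instance Definition _ (R : Type) := gen_choiceMixin (fps R).

Section FpsRing.
Variable R : comNzRingType.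
Implicit Types x y z : fps R.

Definition fps_zero : fps R := Fps (fun=> 0).
Definition fps_opp x : fps R := Fps (fun n => - coef x n).
Definition fps_add x y : fps R := Fps (fun n => coef x n + coef y n).
Definition fps_one : fps R := Fps (fun n => (n == 0)%:R).
Definition fps_mul x y : fps R :=
  Fps (fun n => \sum_(i < n.+1) coef x i * coef y (n - i)).

Lemma fps_addA : associative fps_add.
Proof. by move=> x y z; apply/fpsP => n /=; rewrite addrA. Qed.

Lemma fps_addC : commutative fps_add.
Proof. by move=> x y; apply/fpsP => n /=; rewrite addrC. Qed.

Lemma fps_add0 : left_id fps_zero fps_add.
Proof. by move=> x; apply/fpsP => n /=; rewrite add0r. Qed.

Lemma fps_addN : left_inverse fps_zero fps_opp fps_add.
Proof. by move=> x; apply/fpsP => n /=; rewrite addNr. Qed.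

HB.instance Definition _ :=
  GRing.isZmodule.Build (fps R) fps_addA fps_addC fps_add0 fps_addN.

Definition fps_trunc n x : {poly R} := \poly_(i < n.+1) coef x i.

Lemma coef_fps_trunc n x i : (i <= n)%N -> (fps_trunc n x)`_i = coef x i.
Proof. by move=> le_in; rewrite coef_poly ltnS le_in. Qed.

Lemma fps_mul_trunc n x y i : (i <= n)%N ->
  coef (fps_mul x y) i = (fps_trunc n x * fps_trunc n y)`_i.
Proof.
move=> le_in; rewrite coefM /=; apply: eq_bigr => -[j /=]; rewrite ltnS => le_ji _.
by rewrite !coef_fps_trunc // ?(leq_trans le_ji) // (leq_trans (leq_subr _ _)).
Qed.

Lemma fps_mulC : commutative fps_mul.
Proof.
by move=> x y; apply/fpsP => n; rewrite !(fps_mul_trunc _ _ (leqnn n)) mulrC.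
Qed.

Lemma fps_mulA : associative fps_mul.
Proof.
move=> x y z; apply/fpsP => n.
transitivity ((fps_trunc n x * fps_trunc n y * fps_trunc n z)`_n).
  rewrite -mulrA coefM /=; apply: eq_bigr => -[i /=]; rewrite ltnS => le_in _.
  by rewrite coef_fps_trunc // -fps_mul_trunc // leq_subr.
rewrite coefM /=; apply: eq_bigr => -[i /=]; rewrite ltnS => le_in _.
by rewrite coef_fps_trunc ?leq_subr // -fps_mul_trunc.
Qed.

Lemma fps_mul1 : left_id fps_one fps_mul.
Proof.
move=> x; apply/fpsP => n /=.
by rewrite big_ord_recl /= mul1r subn0 big1 ?addr0 // => i _; rewrite mul0r.
Qed.

Lemma fps_mulDl : left_distributive fps_mul fps_add.
Proof.
move=> x y z; apply/fpsP => n /=; rewrite -big_split /=.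
by apply: eq_bigr => i _; rewrite mulrDl.
Qed.

Lemma fps_oner_neq0 : fps_one != fps_zero.
Proof.
by apply/eqP => /fpsP /(_ 0%N) /= /eqP; rewrite oner_eq0.
Qed.

HB.instance Definition _ := GRing.Zmodule_isComNzRing.Build (fps R)
  fps_mulA fps_mulC fps_mul1 fps_mulDl fps_oner_neq0.

Lemma fps_coef0 n : coef (0 : fps R) n = 0. Proof. by []. Qed.
Lemma fps_coef1 n : coef (1 : fps R) n = (n == 0)%:R. Proof. by []. Qed.
Lemma fps_coefD x y n : coef (x + y) n = coef x n + coef y n. Proof. by []. Qed.
Lemma fps_coefN x n : coef (- x) n = - coef x n. Proof. by []. Qed.
Lemma fps_coefB x y n : coef (x - y) n = coef x n - coef y n. Proof. by []. Qed.
Lemma fps_coefM x y n :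
  coef (x * y) n = \sum_(i < n.+1) coef x i * coef y (n - i).
Proof. by []. Qed.

Lemma fps_coef_sum I (r : seq I) (P : pred I) (F : I -> fps R) n :
  coef (\sum_(i <- r | P i) F i) n = \sum_(i <- r | P i) coef (F i) n.
Proof. by elim/big_rec2: _ => // i _ y _ <-. Qed.

Lemma fps_coef0M x y : coef (x * y) 0 = coef x 0 * coef y 0.
Proof. by rewrite fps_coefM big_ord1. Qed.

Definition fpsX : fps R := Fps (fun n => (n == 1)%:R).

Lemma coef_fpsXM x n : coef (fpsX * x) n = if n is m.+1 then coef x m else 0.
Proof.
rewrite fps_coefM big_ord_recl /= mul0r add0r.
case: n => [|n]; first by rewrite big_ord0.
rewrite big_ord_recl /= mul1r big1 ?addr0 ?subSS ?subn0 // => i _.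
by rewrite mul0r.
Qed.

Lemma coef_fpsXnM x k n :
  coef (fpsX ^+ k * x) n = if (n < k)%N then 0 else coef x (n - k).
Proof.
elim: k n => [|k IHk] n; first by rewrite expr0 mul1r subn0.
by rewrite exprS -mulrA coef_fpsXM; case: n => [|n] //; rewrite IHk ltnS subSS.
Qed.

Lemma coef_fpsXn k n : coef (fpsX ^+ k) n = (n == k)%:R.
Proof.
rewrite -[_ ^+ _]mulr1 coef_fpsXnM fps_coef1 subn_eq0 eqn_leq.
by case: ltnP => [lt_nk|le_kn]; rewrite ?andbT // andbF.
Qed.

(** Infinite sums and products: limits for the q-adic topology, i.e., the limit
    of u is the series each coefficient of which is the eventual value of the
    corresponding coefficient of u (0 if it is not eventually constant). *)

Definition fps_lim (u : nat -> fps R) : fps R :=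
  Fps (fun n => xget 0 [set c | \forall N \near \oo, coef (u N) n = c]).

Definition fps_series (F : nat -> fps R) : fps R :=
  fps_lim (fun N => \sum_(i < N) F i).

Definition fps_infprod (F : nat -> fps R) : fps R :=
  fps_lim (fun N => \prod_(i < N) F i).

Lemma coef_fps_lim u n M :
  (forall N, (M <= N)%N -> coef (u N) n = coef (u M) n) ->
  coef (fps_lim u) n = coef (u M) n.
Proof.
move=> u_const; apply: xget_unique => [|c [M' _ uc]]; first by exists M.
by rewrite -(uc (maxn M M')) ?u_const ?leq_maxl //= leq_maxr.
Qed.

Lemma coef_fps_series F n M :
  (forall i, (M <= i)%N -> coef (F i) n = 0) ->
  coef (fps_series F) n = \sum_(i < M) coef (F i) n.
Proof.
move=> F0; rewrite /fps_series (@coef_fps_lim _ n M) ?fps_coef_sum // => N le_MN.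
rewrite -!(big_mkord xpredT) (big_cat_nat (leq0n M) le_MN) fps_coefD.
rewrite !fps_coef_sum [X in _ + X]big_nat_cond.
rewrite [X in _ + X]big1 ?addr0 ?big_mkord // => i.
by case/andP => /andP[/F0].
Qed.

Lemma coef_fps_infprod (F : nat -> fps R) n M :
  (forall i j, (M <= i)%N -> (j <= n)%N -> coef (F i) j = (j == 0)%:R) ->
  coef (fps_infprod F) n = coef (\prod_(i < M) F i) n.
Proof.
move=> F1; apply: coef_fps_lim => N /subnK <-.
elim: (N - M)%N => // k IHk; rewrite addSn big_ord_recr fps_coefM big_ord_recr.
rewrite subnn F1 ?leq_addl // mulr1 IHk big1 => [|i _]; first exact: add0r.
by rewrite F1 ?leq_addl ?leq_subr // subn_eq0 leqNgt (ltn_ord i) mulr0.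
Qed.

(** [qpoch a p n] is the q-shifted factorial (a; p)_n. *)

Definition qpoch (a p : fps R) (n : nat) : fps R :=
  \prod_(k < n) (1 - a * p ^+ k).

End FpsRing.

Arguments fpsX {R}.

Section FpsUnit.
Variable R : comUnitRingType.
Implicit Types x y : fps R.

Definition fps_unit : {pred fps R} :=
  [pred x | coef x 0 \is a GRing.unit].

(* The list of the coefficients of degree < n of the inverse of x, in reverse
   order: x_0 y_n = - \sum_(j < n) x_(j+1) y_(n-1-j) for n > 0. *)
Fixpoint fps_inv_rec x n : seq R :=
  if n is m.+1 then
    let s := fps_inv_rec x m in
    (coef x 0)^-1 * ((m == 0)%:R - \sum_(j < m) coef x j.+1 * s`_j) :: s
  else [::].

Definition fps_inv x : fps R :=
  if x \in fps_unit then Fps (fun n => (fps_inv_rec x n.+1)`_0) else x.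

Lemma nth_fps_inv_rec x n j : (j < n)%N ->
  (fps_inv_rec x n)`_j = (fps_inv_rec x (n - j))`_0.
Proof.
by elim: n j => // n IHn [|j] // lt_jn; rewrite [LHS]/= IHn.
Qed.

Lemma fps_mulVx : {in fps_unit, left_inverse 1 fps_inv *%R}.
Proof.
move=> x x_unit; rewrite mulrC /fps_inv x_unit; apply/fpsP => n.
rewrite fps_coefM fps_coef1 big_ord_recl /= mulVKr // -addrA subn0.
rewrite -sumrN -big_split /= big1 ?addr0 // => -[i lt_in] _ /=.
rewrite nth_fps_inv_rec // /bump /= add1n.
have -> : (n - i = (n - i.+1).+1)%N by rewrite subnSK.
by rewrite /= addNr.
Qed.

Lemma fps_unitPl x y : y * x = 1 -> fps_unit x.
Proof.
move=> /fpsP /(_ 0%N); rewrite fps_coef0M fps_coef1 mulrC => xy1.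
by apply/unitrPr; exists (coef y 0).
Qed.

Lemma fps_inv_out : {in [predC fps_unit], fps_inv =1 id}.
Proof. by move=> x; rewrite /fps_inv inE /= => /negbTE ->. Qed.

HB.instance Definition _ := GRing.ComNzRing_hasMulInverse.Build (fps R)
  fps_mulVx fps_unitPl fps_inv_out.

Lemma fps_unitE x : (x \is a GRing.unit) = (coef x 0 \is a GRing.unit).
Proof. by []. Qed.

End FpsUnit.

Local Notation q := (fpsX : fps int).

(* \prod_(m >= 1) (1 - q ^ (k * m)) *)
Definition ell (k : nat) : fps int :=
  fps_infprod (fun m => 1 - q ^+ (k * m.+1)).

Definition overpartition3_gf : fps int := (ell 2 / ell 1 ^+ 2) ^+ 3.

Definition pbar3 (m : int) : int :=
  if m is Posz n then coef overpartition3_gf n else 0.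

Definition lambda_term (n : nat) : fps int :=
  (-1) ^+ n * q ^+ n * qpoch q (q ^+ 2) n / qpoch (- q) q n.

Definition lambda : fps int := fps_series lambda_term.

Definition P_lambda (n : nat) : int := coef lambda n.

(* ell_coef and P_lambdaE show that the limits defining ell and lambda exist;
   ell_unit and qpoch_Nq_unit show that the quotients are by units (x^-1 is x
   when x is not a unit). *)

Lemma ell_coef k n : (0 < k)%N ->
  coef (ell k) n = coef (\prod_(m < n) (1 - q ^+ (k * m.+1))) n.
Proof.
move=> k_gt0; apply: coef_fps_infprod => i j le_ni le_jn.
rewrite fps_coefB fps_coef1 coef_fpsXn; case: (j =P (k * i.+1)%N) => [j_eq|_].
  suff: (i.+1 <= j)%N by move=> lt_ij; have := leq_trans lt_ij (leq_trans le_jn le_ni); rewrite ltnn.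
  by rewrite j_eq leq_pmull.
by rewrite subr0.
Qed.

Lemma ell_unit k : (0 < k)%N -> ell k \is a GRing.unit.
Proof.
by move=> k_gt0; rewrite fps_unitE ell_coef // big_ord0 fps_coef1 unitr1.
Qed.

Lemma qpoch_Nq_unit n : qpoch (- q) q n \is a GRing.unit.
Proof.
rewrite /qpoch; elim/big_ind: _ => [||i _]; first exact: unitr1.
  by move=> x y; rewrite unitrM => -> ->.
by rewrite fps_unitE fps_coefB fps_coef1 mulNr fps_coefN coef_fpsXM oppr0 subr0 unitr1.
Qed.

Lemma P_lambdaE n : P_lambda n = \sum_(j < n.+1) coef (lambda_term j) n.
Proof.
apply: coef_fps_series => j lt_nj.
rewrite /lambda_term -!mulrA mulrCA coef_fpsXnM.
by rewrite lt_nj.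
Qed.

(* In the finitely supported sums \sum_(i \in A) of the library, a sum with an
   infinite support is 0; this does not occur for the sums involving pbar3. *)
Lemma pbar3_lt0 (m : int) : m < 0 -> pbar3 m = 0.
Proof. by case: m. Qed.

Lemma fsum_pbar3 (n : nat) (A : set nat) (c : nat -> int) (a : nat -> nat) :
    (forall k, k <= a k)%N ->
  \sum_(k \in A) c k * pbar3 (n%:Z - (a k)%:Z) =
  \sum_(0 <= k < n.+1 | k \in A) c k * pbar3 (n%:Z - (a k)%:Z).
Proof.
move=> le_a; rewrite [LHS]fsbig_mkcond (@fsbigE _ _ _ _ _ (index_iota 0 n.+1)).
- rewrite -big_mkcondr /=; apply: eq_bigl => k; rewrite in_setT //.
- exact: iota_uniq.
- by [].
move=> k _; rewrite mem_index_iota -leqNgt => lt_nk; rewrite /patch.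
case: ifP => // _; rewrite pbar3_lt0 ?mulr0 // subr_lt0 ltz_nat.
exact: leq_trans (le_a k).
Qed.

Lemma fsum2_pbar3 (n : nat) (A : set nat) (c : nat -> nat -> int)
    (a b : nat -> nat) :
    (forall k, k <= a k)%N -> (forall l, l <= b l)%N ->
  \sum_(l \in [set: nat]) \sum_(k \in A)
    c l k * pbar3 (n%:Z - (a k)%:Z - (b l)%:Z) =
  \sum_(0 <= l < n.+1) \sum_(0 <= k < n.+1 | k \in A)
    c l k * pbar3 (n%:Z - (a k)%:Z - (b l)%:Z).
Proof.
move=> le_a le_b.
have innerE l : \sum_(k \in A) c l k * pbar3 (n%:Z - (a k)%:Z - (b l)%:Z) =
    \sum_(0 <= k < n.+1 | k \in A) c l k * pbar3 (n%:Z - (a k)%:Z - (b l)%:Z).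
  under eq_fsbigr do rewrite -addrA -opprD -PoszD.
  under [RHS]eq_bigr do rewrite -addrA -opprD -PoszD.
  by apply: fsum_pbar3 => k; rewrite (leq_trans (le_a k)) ?leq_addr.
under eq_fsbigr do rewrite innerE.
rewrite (@fsbigE _ _ _ _ _ (index_iota 0 n.+1)) ?iota_uniq //.
  by apply: eq_bigl => l; rewrite in_setT.
move=> l _; rewrite mem_index_iota -leqNgt => lt_nl; rewrite big1 // => k _.
rewrite pbar3_lt0 ?mulr0 // -addrA -opprD -PoszD subr_lt0 ltz_nat.
by rewrite (leq_trans lt_nl) // (leq_trans (le_b l)) ?leq_addl.
Qed.

(* Main.v *)
Require Import Defs.
From mathcomp Require Import all_boot all_order all_algebra.
From mathcomp Require Import boolp classical_sets fsbigop.
From mathcomp Require Import algC cyclotomic ring lra zify.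

(** Throughout, T_n = n (n + 1) / 2 and
      phi(q) = sum_(k in Z) (-1)^k q^(k^2),   psi(q) = sum_(n >= 0) q^(T_n),
      J(q) = sum_(n >= 0) (-1)^n (2 n + 1) q^(T_n),
    so that, with P = P_lambda and l_m = ell m, the two sums of the theorem are the coefficients of
    3 J(q^3) phi(q^3) / phi(q)^3: indeed phi = l_1^2 / l_2, whence the
    generating function of the 3-coloured overpartitions is phi(q)^(-3), and
    phi(q^3) is 1 plus twice its part with k >= 1.

    The mock theta function disappears in two steps.  First, lambda(q) is a sum
    of the form sum_n (q; q^2)_n (-q)^n beta_n with beta_n = 1 / (-q)_n.  The
    Bailey transform turns it into a sum over the partner of beta, times a
    factor common to all Bailey pairs; the unit pair shows that the factor is
    1 / psi(q).  The partner of 1 / (-q)_n satisfies a first order recurrence,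
    and the outcome (lambda_hecke, hecke_sumE) is
      lambda(q) psi(q) = sum_(n >= 0, |j| <= n) (-1)^(n + j) q^(3 T_n - j^2).
    Secondly, multiply by phi(q) and replace k by k - j: the square of j leaves
    the exponent, which becomes 3 T_n + k^2 - 2 k j.  The terms with k = 0 sum
    up to J(q^3).  For k > 0 the sum over j is geometric and leaves a bilateral
    theta series, which is 0 or an odd power of q times the pentagonal series
    l_1 = prod_m (1 - q^m), divided by 1 - q^(2 k).  Since psi(q) l_1 = l_2^2
    is even in q, the terms with k > 0 do not contribute to the even part
    (even_part_psi_hecke):
      even part of psi(q)^2 phi(q) lambda(q) = even part of psi(q) J(q^3).
    Here psi(q)^2 phi(q) = l_2^3 is even as well.

    The rest is about theta series.  A rotation of the lattice of Eisenstein
    integers gives the even part of psi(q) J(q^3) as J(q^4) phi(q^6)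
    (even_part_psi_jac), so that (sect_even_lambda)
      sum_n P(2 n) q^n = psi(q) phi(q^3) / phi(q).
    Finally psi(q) = A(q^3) + q psi(q^9) and phi(q) = phi(q^9) - 2 q B(q^3), for
    two theta series A and B (cubic_psi, cubic_phi) with
    A B = psi(q^3) phi(q^3).  Multiplying phi(q) by its two conjugates
    under q -> w q, w^3 = 1, makes the denominator a series in q^3, equal to
    phi(q^3)^4 / phi(q^9) (phi_cubic_norm); reading off the exponents 1 mod 3
    gives sum_n P(6 n + 2) q^n = 3 psi(q^3) phi(q^3)^3 / phi(q)^3, and
    J = psi phi^2.

    The product formulas for phi, psi, J, A, B and the pentagonal series are all
    instances of one form of the Jacobi triple product (triple_product), which
    is the limit of a finite identity over the same kernel
    1 / ((q)_(n - k) (q)_(n + k + 1)) as in the Bailey transform. *)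

Set Implicit Arguments.
Unset Strict Implicit.
Unset Printing Implicit Defensive.

Import Order.TTheory GRing.Theory Num.Theory.

Local Open Scope classical_set_scope.
Local Open Scope ring_scope.

Local Notation q := (fpsX : fps int).

(** * Summable families of power series *)

(** Coefficientwise sum over an arbitrary index type. A coefficient to which
    infinitely many terms contribute is 0; [summable] excludes this. *)
Definition fps_sum (I : choiceType) (F : I -> fps int) : fps int :=
  Fps (fun n => \sum_(i \in [set: I]) coef (F i) n).

Definition summable (I : choiceType) (F : I -> fps int) : Prop :=
  forall n, exists r : seq I,
    forall i m, (m <= n)%N -> coef (F i) m != 0 -> i \in r.

Lemma coef_fps_sum_seq (I : choiceType) (F : I -> fps int) (r : seq I) n :
  uniq r -> (forall i, coef (F i) n != 0 -> i \in r) ->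
  coef (fps_sum F) n = \sum_(i <- r) coef (F i) n.
Proof.
move=> r_uniq rP; rewrite /= (fsbigE (A := [set: I]) r) //.
  by apply: eq_bigl => i; rewrite in_setT.
by move=> i _ ir; apply/eqP; apply: contraNT ir => /rP.
Qed.

Lemma eq_fps_sum (I : choiceType) (F G : I -> fps int) :
  F =1 G -> fps_sum F = fps_sum G.
Proof. by move=> /funext ->. Qed.

Lemma eq_summable (I : choiceType) (F G : I -> fps int) :
  F =1 G -> summable F -> summable G.
Proof. by move=> /funext ->. Qed.

Lemma summable_seq (I : choiceType) (F : I -> fps int) n :
  summable F -> exists2 r : seq I, uniq r &
    forall i m, (m <= n)%N -> coef (F i) m != 0 -> i \in r.
Proof.
move=> /(_ n)[r rP]; exists (undup r); first exact: undup_uniq.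
by move=> i m le_mn Fim; rewrite mem_undup (rP i m).
Qed.

Lemma fps_sum_seq (I : choiceType) (F : I -> fps int) (r : seq I) :
  uniq r -> (forall i, i \notin r -> F i = 0) ->
  fps_sum F = \sum_(i <- r) F i.
Proof.
move=> r_uniq F0; apply/fpsP => n; rewrite (@coef_fps_sum_seq _ _ r) //.
  by rewrite fps_coef_sum.
by move=> i; apply: contraNT => /F0 ->.
Qed.

Lemma fps_sumD (I : choiceType) (F G : I -> fps int) :
  summable F -> summable G ->
  fps_sum (fun i => F i + G i) = fps_sum F + fps_sum G.
Proof.
move=> sF sG; apply/fpsP => n; rewrite fps_coefD.
have [r r_uniq rP] := summable_seq n sF; have [s _ sP] := summable_seq n sG.
rewrite !(@coef_fps_sum_seq _ _ (undup (r ++ s))) ?undup_uniq -?big_split //.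
- by move=> i /sP; rewrite mem_undup mem_cat orbC => ->.
- by move=> i /rP; rewrite mem_undup mem_cat => ->.
move=> i; rewrite fps_coefD mem_undup mem_cat.
apply: contraNT; rewrite negb_or => /andP[ir is_].
by rewrite (contraNeq (rP i n (leqnn n)) ir) (contraNeq (sP i n (leqnn n)) is_) addr0.
Qed.

Lemma fps_mulr_sumr (I : choiceType) (F : I -> fps int) (c : fps int) :
  summable F -> c * fps_sum F = fps_sum (fun i => c * F i).
Proof.
move=> sF; apply/fpsP => n; have [r r_uniq rP] := summable_seq n sF.
have F0 i m : (m <= n)%N -> i \notin r -> coef (F i) m = 0.
  by move=> le_mn; exact: (contraNeq (rP i m le_mn)).
rewrite (@coef_fps_sum_seq _ _ r) //; last first.
  move=> i; apply: contraNT => ir; rewrite fps_coefM big1 // => j _.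
  by rewrite F0 ?mulr0 ?leq_subr.
under [RHS]eq_bigr do rewrite fps_coefM.
rewrite exchange_big fps_coefM; apply: eq_bigr => j _ /=.
rewrite -mulr_sumr; congr (_ * _); apply: (@coef_fps_sum_seq _ _ r) => // i.
by apply: rP; rewrite leq_subr.
Qed.

Lemma summableM (I : choiceType) (F : I -> fps int) (c : I -> fps int) :
  summable F -> summable (fun i => c i * F i).
Proof.
move=> sF n; have [r rP] := sF n; exists r => i m le_mn.
apply: contraNT => ir; rewrite fps_coefM big1 // => j _.
rewrite (contraNeq (rP i (m - j)%N _)) ?mulr0 //.
by rewrite (leq_trans _ le_mn) ?leq_subr.
Qed.

Lemma fps_sumN (I : choiceType) (F : I -> fps int) :
  summable F -> fps_sum (fun i => - F i) = - fps_sum F.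
Proof.
by move=> sF; rewrite -mulN1r fps_mulr_sumr //; apply: eq_fps_sum => i; rewrite mulN1r.
Qed.

Lemma summableN (I : choiceType) (F : I -> fps int) :
  summable F -> summable (fun i => - F i).
Proof.
by move=> sF n; have [r rP] := sF n; exists r => i m; rewrite fps_coefN oppr_eq0; apply: rP.
Qed.

Lemma summableD (I : choiceType) (F G : I -> fps int) :
  summable F -> summable G -> summable (fun i => F i + G i).
Proof.
move=> sF sG n; have [r rP] := sF n; have [s sP] := sG n; exists (r ++ s) => i m le_mn.
apply: contraNT; rewrite mem_cat negb_or => /andP[ir is_].
by rewrite fps_coefD (contraNeq (rP i m le_mn) ir) (contraNeq (sP i m le_mn) is_) addr0.
Qed.

Lemma summable_comp (I J : choiceType) (h : J -> I) (F : I -> fps int) :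
  injective h -> summable F -> summable (F \o h).
Proof.
move=> h_inj sF n; have [r rP] := sF n.
have [s sP] : exists s : seq J, forall j, h j \in r -> j \in s.
  elim: r {rP} => [|i r [s sP]]; first by exists [::].
  have [[j0 hj0]|nh] := pselect (exists j, h j = i).
    exists (j0 :: s) => j; rewrite !inE => /orP[/eqP|/sP ->]; last by rewrite orbT.
    by rewrite -hj0 => /h_inj ->; rewrite eqxx.
  exists s => j; rewrite inE => /orP[/eqP hj|/sP //].
  by case: nh; exists j.
by exists s => j m le_mn Fm; apply/sP/(rP _ m).
Qed.

(** The terms outside the image of h vanish: this covers changes of variables as
    well as restrictions to a part of the index type. *)
Lemma fps_sum_inj (I J : choiceType) (h : J -> I) (F : I -> fps int) :
  injective h -> (forall i, (forall j, h j <> i) -> F i = 0) ->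
  fps_sum F = fps_sum (F \o h).
Proof.
move=> h_inj F0; apply/fpsP => n /=.
rewrite -(@fsbig_widen _ _ _ _ (range h)) //; last first.
  by move=> i [_ /= hi]; rewrite F0 // => j hj; apply: hi; exists j.
rewrite (@fsbig_image _ _ _ _ _ [set: J] h (fun i => coef (F i) n)) //.
by move=> x y _ _ /h_inj.
Qed.

Lemma fps_sum_bij (I J : choiceType) (h : J -> I) (g : I -> J) (F : I -> fps int) :
  cancel h g -> cancel g h -> fps_sum F = fps_sum (F \o h).
Proof.
move=> hK gK; apply: fps_sum_inj (can_inj hK) _ => i hi.
by case: (hi (g i)); rewrite gK.
Qed.

Lemma summable_pair (I J : choiceType) (F : I * J -> fps int) :
  (forall n, exists (r : seq I) (s : seq J), forall i j m, (m <= n)%N ->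
     coef (F (i, j)) m != 0 -> (i \in r) && (j \in s)) ->
  summable F.
Proof.
move=> h n; have [r [s rsP]] := h n; exists [seq (i, j) | i <- r, j <- s].
by move=> [i j] m le_mn /rsP - /(_ le_mn)/andP[ir js]; apply: allpairs_f.
Qed.

Lemma summable_mul (I J : choiceType) (F : I -> fps int) (G : J -> fps int) :
  summable F -> summable G -> summable (fun ij => F ij.1 * G ij.2).
Proof.
move=> sF sG; apply: summable_pair => n; have [r rP] := sF n; have [s sP] := sG n.
exists r, s => i j m le_mn; apply: contraNT; rewrite negb_and => ijrs.
rewrite fps_coefM big1 // => k _; case/orP: ijrs => [ir|js].
  by rewrite (contraNeq (rP i k _) ir) ?mul0r // (leq_trans _ le_mn) // -ltnS.
by rewrite (contraNeq (sP j (m - k)%N _) js) ?mulr0 // (leq_trans (leq_subr _ _) le_mn).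
Qed.

Lemma fps_sum_pair (I J : choiceType) (F : I * J -> fps int) :
  summable F -> fps_sum F = fps_sum (fun i => fps_sum (fun j => F (i, j))).
Proof.
move=> sF; apply/fpsP => n; have [r _ rP] := summable_seq n sF.
pose r1 := undup [seq ij.1 | ij <- r]; pose r2 := undup [seq ij.2 | ij <- r].
have r12 i j : coef (F (i, j)) n != 0 -> (i \in r1) && (j \in r2).
  by move=> /(rP _ n (leqnn n)) ijr; rewrite !mem_undup (map_f fst ijr) (map_f snd ijr).
have rowE i : coef (fps_sum (fun j => F (i, j))) n = \sum_(j <- r2) coef (F (i, j)) n.
  by apply: coef_fps_sum_seq => [|j /r12/andP[]//]; exact: undup_uniq.
rewrite (@coef_fps_sum_seq _ _ [seq (i, j) | i <- r1, j <- r2]); last 2 first.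
- by apply: allpairs_uniq; rewrite ?undup_uniq // => -[? ?] [? ?].
- by move=> [i j] /r12/andP[ir js]; apply: allpairs_f.
rewrite (@coef_fps_sum_seq _ _ r1) ?undup_uniq //; last first.
  move=> i; rewrite rowE; apply: contraNT => ir; rewrite big1_seq // => j _.
  by apply/eqP; apply: contraNT ir => /r12/andP[].
by rewrite big_allpairs; apply: eq_bigr => i _; rewrite rowE.
Qed.

Lemma summable_fst (I J : choiceType) (F : I * J -> fps int) :
  summable F -> summable (fun i => fps_sum (fun j => F (i, j))).
Proof.
move=> sF n; have [r rP] := sF n; exists [seq ij.1 | ij <- r] => i m le_mn.
apply: contraNT => ir; rewrite /fps_sum /= fsbig1 // => j _.
by apply/eqP; apply: contraNT ir => /(rP _ m le_mn)/(map_f fst).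
Qed.

Lemma summable_swap (I J : choiceType) (F : I * J -> fps int) :
  summable F -> summable (fun ji : J * I => F (ji.2, ji.1)).
Proof.
move=> sF; apply: (@summable_comp _ _ (fun ji : J * I => (ji.2, ji.1))) => //.
by move=> [j i] [j' i'] [-> ->].
Qed.

Lemma fps_sum_exchange (I J : choiceType) (F : I -> J -> fps int) :
  summable (fun ij => F ij.1 ij.2) ->
  fps_sum (fun i => fps_sum (fun j => F i j)) =
  fps_sum (fun j => fps_sum (fun i => F i j)).
Proof.
move=> sF; rewrite -(@fps_sum_pair _ _ (fun ij => F ij.1 ij.2)) //.
rewrite -(@fps_sum_pair _ _ (fun ji => F ji.2 ji.1)); last exact: (summable_swap sF).
by apply: (@fps_sum_bij _ _ (fun ji => (ji.2, ji.1)) (fun ji => (ji.2, ji.1))); case.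
Qed.

Lemma fps_sumM (I J : choiceType) (F : I -> fps int) (G : J -> fps int) :
  summable F -> summable G ->
  fps_sum F * fps_sum G = fps_sum (fun ij => F ij.1 * G ij.2).
Proof.
move=> sF sG; rewrite fps_sum_pair; last exact: summable_mul.
rewrite mulrC fps_mulr_sumr //; apply: eq_fps_sum => i.
by rewrite mulrC fps_mulr_sumr.
Qed.

Lemma summable_nat (F : nat -> fps int) :
  (forall i n, (n < i)%N -> coef (F i) n = 0) -> summable F.
Proof.
move=> F0 n; exists (iota 0 n.+1) => i m le_mn; rewrite mem_iota /= add0n ltnS.
by apply: contraNT; rewrite -ltnNge => lt_ni; rewrite F0 // (leq_ltn_trans le_mn).
Qed.

Definition int_range (n : nat) : seq int :=
  [seq k%:Z - n%:Z | k <- iota 0 (n + n).+1].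

Lemma mem_int_range n (z : int) : (z \in int_range n) = (`|z| <= n)%N.
Proof.
apply/mapP/idP => [[k]|le_zn]; first by rewrite mem_iota => /= + ->; lia.
by exists (absz (z + n%:Z)); [rewrite mem_iota|]; lia.
Qed.

Lemma int_range_uniq n : uniq (int_range n).
Proof. by rewrite map_inj_uniq ?iota_uniq // => x y /(addIr _) []. Qed.

Lemma fps_series_sum (F : nat -> fps int) :
  (forall i n, (n < i)%N -> coef (F i) n = 0) -> fps_series F = fps_sum F.
Proof.
move=> F0; apply/fpsP => n; rewrite (@coef_fps_series _ _ _ n.+1); last first.
  by move=> i lt_ni; apply: F0.
rewrite (@coef_fps_sum_seq _ _ (iota 0 n.+1)) ?iota_uniq //; last first.
  by move=> i; rewrite mem_iota add0n ltnS; apply: contraNT; rewrite -ltnNge => /F0 ->.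
by rewrite -(big_mkord xpredT (fun i => coef (F i) n)) /index_iota subn0.
Qed.

(** Triangular numbers are invariant under k -> -1 - k, not under k -> -k: this
    is the way in which the bilateral theta series below fold. *)
Lemma fps_sum_int (F : int -> fps int) : summable F ->
  fps_sum F = fps_sum (fun n : nat => F n%:Z + F (- 1 - n%:Z)).
Proof.
move=> sF.
have sp : summable (fun n : nat => F n%:Z).
  by apply: (@summable_comp _ _ Posz) => // x y [].
have sn : summable (fun n : nat => F (- 1 - n%:Z)).
  by apply: (@summable_comp _ _ (fun n : nat => - 1 - n%:Z)) => // x y; lia.
rewrite fps_sumD //.
pose Fp z := if 0 <= z then F z else 0; pose Fn z := if 0 <= z then 0 else F z.
rewrite (@eq_fps_sum _ F (fun z => Fp z + Fn z)); last first.
  by move=> z; rewrite /Fp /Fn; case: ifP; rewrite ?addr0 ?add0r.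
have sub (P : pred int) : summable (fun z => if P z then F z else 0).
  move=> n; have [r rP] := sF n; exists r => z m le_mn.
  by case: ifP => _; [exact: rP | rewrite fps_coef0 eqxx].
rewrite fps_sumD; last 2 first.
- exact: sub.
- rewrite /Fn (_ : (fun z => _) = (fun z : int => if ~~ (0 <= z) then F z else 0)).
    exact: (sub (fun z => ~~ (0 <= z))).
  by apply/funext => z; case: ifP.
congr (_ + _).
  rewrite (@fps_sum_inj _ _ Posz Fp) //; first by move=> x y [].
  by move=> [n|n] h; [case: (h n)|].
rewrite (@fps_sum_inj _ _ (fun n : nat => - 1 - n%:Z) Fn) /=.
- by apply: eq_fps_sum => n /=; rewrite /Fn; case: ifP => //; lia.
- by move=> x y /=; lia.
move=> z h; rewrite /Fn; case: ifP => // z0; case: (h (absz (z + 1))); lia.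
Qed.

Arguments coef : simpl never.

Lemma fps_unit1 (F : fps int) : coef F 0 = 1 -> F \is a GRing.unit.
Proof. by move=> F1; rewrite fps_unitE F1 unitr1. Qed.

Lemma coef_prod0 (I : Type) (r : seq I) (P : pred I) (F : I -> fps int) :
  (forall i, coef (F i) 0 = 1) -> coef (\prod_(i <- r | P i) F i) 0 = 1.
Proof.
move=> F1; apply: (big_ind (fun x => coef x 0 = 1)) => // x y x1 y1.
by rewrite fps_coef0M x1 y1.
Qed.

Lemma coef_1B0 (F : fps int) : coef F 0 = 0 -> coef (1 - F) 0 = 1.
Proof. by move=> F0; rewrite fps_coefB F0 subr0. Qed.

(** * Reciprocals of q-factorials *)

Section Recip.
Variables (p : fps int) (p0 : coef p 0 = 0).

Definition invfac (n : nat) : fps int := (qpoch p p n)^-1.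

(** The shift of invfac with the natural convention 1 / (p; p)_(-1) = 0; the
    sums below then end by themselves. *)
Definition invfac_pred (n : nat) : fps int := if n is m.+1 then invfac m else 0.

Let coef_pX n : coef (1 - p ^+ n.+1) 0 = 1.
Proof. by rewrite coef_1B0 // exprS fps_coef0M p0 mul0r. Qed.

Lemma qpoch_unit n : qpoch p p n \is a GRing.unit.
Proof. by apply/fps_unit1/coef_prod0 => i; rewrite -exprS. Qed.

Lemma invfacE n : invfac n = (1 - p ^+ n.+1) * invfac n.+1.
Proof.
rewrite /invfac {2}/qpoch big_ord_recr /= -exprS invrM ?qpoch_unit ?fps_unit1 //.
by rewrite mulrA divrr ?mul1r // fps_unit1.
Qed.

Lemma invfac_predE n : invfac_pred n = (1 - p ^+ n) * invfac n.
Proof. by case: n => [|n] /=; rewrite ?expr0 ?subrr ?mul0r // invfacE. Qed.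

(** It is 1 / ((p; p)_(n - k) (p; p)_(n + k + 1)), and 0 for k > n: the truncated
    subtraction then gives invfac_pred 0 = 0. *)
Definition bailey_kernel (n k : nat) : fps int :=
  invfac_pred (n.+1 - k) * invfac (n + k).+1.

Lemma bailey_kernel_gt n k : (n < k)%N -> bailey_kernel n k = 0.
Proof. by rewrite -subn_eq0 /bailey_kernel => /eqP ->; rewrite mul0r. Qed.

End Recip.

(** * The Bailey transform *)

Section Bailey.

Local Notation ip := (invfac q).
Local Notation ipred := (invfac_pred q).
Local Notation dd := (bailey_kernel q).

Let ipE n : ip n = (1 - q * q ^+ n) * ip n.+1.
Proof. by rewrite invfacE // exprS. Qed.

Let ipredE n : ipred n = (1 - q ^+ n) * ip n. Proof. exact: invfac_predE. Qed.

(** (alpha, beta) is a Bailey pair relative to a = q when beta = bailey_beta B for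
    alpha_r = (1 - q^(2 r + 1)) / (1 - q) B_r. *)
Definition bailey_beta (B : nat -> fps int) (n : nat) : fps int :=
  \sum_(r < n.+1) (1 - q ^+ r.*2.+1) * B r * dd n r.

Let weight (n : nat) : fps int := qpoch q (q ^+ 2) n * (- q) ^+ n.

Definition bailey_factor (r : nat) : fps int :=
  fps_sum (fun n => (1 - q ^+ r.*2.+1) * weight n * dd n r).

Let coef_weightM F n m : (m < n)%N -> coef (weight n * F) m = 0.
Proof.
move=> lt_mn; rewrite /weight -mulrA mulrCA exprNn -!mulrA mulrCA coef_fpsXnM.
by rewrite lt_mn.
Qed.

Let coef_term F n r m : (m < n)%N ->
  coef ((1 - q ^+ r.*2.+1) * weight n * F) m = 0.
Proof. by move=> lt_mn; rewrite mulrAC mulrC coef_weightM. Qed.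

(** The combination of the summands for r and r + 1 is a difference G_(n+1) - G_n;
    G is the certificate found by creative telescoping. *)
Lemma bailey_factorS r : bailey_factor r.+1 = - q * bailey_factor r.
Proof.
pose G n := - (1 - q ^+ r.*2.+2) * weight n * (ipred (n - r) * ip (n + r).+1).
have GE n : (1 - q ^+ r.+1.*2.+1) * weight n * dd n r.+1 =
    - q * ((1 - q ^+ r.*2.+1) * weight n * dd n r) + (G n.+1 - G n).
  have [lt_nr|/subnK <-] := ltnP n r.
    rewrite !bailey_kernel_gt ?ltnS ?(ltnW lt_nr) // /G.
    have /eqP -> : (n - r == 0)%N by rewrite subn_eq0 ltnW.
    have /eqP -> : (n.+1 - r == 0)%N by rewrite subn_eq0.
    by rewrite /= !(mulr0, mul0r, subrr, addr0).
  rewrite /G /bailey_kernel /weight.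
  have -> : ((n - r + r).+1 - r.+1 = n - r)%N by lia.
  have -> : ((n - r + r).+1 - r = (n - r).+1)%N by lia.
  have -> : (n - r + r - r = n - r)%N by lia.
  have -> : ((n - r + r + r.+1).+1 = (n - r + r.*2).+2)%N by lia.
  have -> : ((n - r + r + r).+1 = (n - r + r.*2).+1)%N by lia.
  have -> : (((n - r + r).+1 + r).+1 = (n - r + r.*2).+2)%N by lia.
  move: (n - r)%N => a /=.
  rewrite /qpoch big_ord_recr /= -/(qpoch q (q ^+ 2) (a + r)).
  move: (qpoch _ _ _) => W.
  rewrite !ipredE (ipE (a + r.*2).+1) -exprM (exprS (- q)).
  move: ((- q) ^+ _) => s; rewrite mulnDr !mul2n -!addnn.
  rewrite !(exprS, exprD).
  by ring.
have sG : summable G.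
  by apply: summable_nat => n m lt_mn; rewrite /G mulrAC mulrC coef_weightM.
have st s : summable (fun n => (1 - q ^+ s.*2.+1) * weight n * dd n s).
  by apply: summable_nat => n m lt_mn; rewrite coef_term.
have sGS : summable (G \o S) by apply: summable_comp sG => x y [].
rewrite /bailey_factor (eq_fps_sum GE) fps_sumD; last 2 first.
- exact: summableM.
- by apply: summableD => //; apply: summableN.
rewrite -fps_mulr_sumr // fps_sumD //; last exact: summableN.
rewrite fps_sumN // -[fps_sum (fun i => G i.+1)](@fps_sum_inj _ _ S G).
- by rewrite subrr addr0.
- by move=> x y [].
by case=> [|n] h; [rewrite /G sub0n mul0r mulr0 | case: (h n)].
Qed.

Lemma bailey_factorE r : bailey_factor r = (- q) ^+ r * bailey_factor 0.
Proof.
by elim: r => [|r IHr]; rewrite ?expr0 ?mul1r // bailey_factorS IHr exprS mulrA.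
Qed.

(** Exchanging the two summations turns the weighted sum of the beta's into a
    sum over the B's, in which all the inner sums are powers of -q times the
    same series. *)
Lemma bailey_transform (B : nat -> fps int) :
  fps_sum (fun n => weight n * bailey_beta B n) =
  bailey_factor 0 * fps_sum (fun r => (- q) ^+ r * B r).
Proof.
pose t n r := (1 - q ^+ r.*2.+1) * weight n * dd n r.
have st : summable (fun nr : nat * nat => B nr.2 * t nr.1 nr.2).
  apply: summableM; apply: summable_pair => n; exists (iota 0 n.+1), (iota 0 n.+1).
  move=> i j m le_mn; rewrite !mem_iota !add0n !ltnS /=.
  apply: contraNT; rewrite negb_and -!ltnNge => ltn; apply/eqP.
  have [lt_mi|le_im] := ltnP m i; first by rewrite /t coef_term.
  by rewrite /t bailey_kernel_gt ?mulr0 //; lia.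
transitivity (fps_sum (fun n => fps_sum (fun r => B r * t n r))).
  apply: eq_fps_sum => n; rewrite (@fps_sum_seq _ _ (iota 0 n.+1)) ?iota_uniq //.
    rewrite /bailey_beta mulr_sumr -(big_mkord xpredT
      (fun r => weight n * ((1 - q ^+ r.*2.+1) * B r * dd n r))) /index_iota subn0.
    by apply: eq_bigr => r _; rewrite /t; ring.
  move=> r; rewrite mem_iota add0n ltnS -ltnNge => lt_nr.
  by rewrite /t bailey_kernel_gt // !mulr0.
rewrite fps_sum_exchange // fps_mulr_sumr; last first.
  apply: summable_nat => r m lt_mr; rewrite exprNn -mulrA mulrCA coef_fpsXnM.
  by rewrite lt_mr.
apply: eq_fps_sum => r; rewrite -fps_mulr_sumr.
  by rewrite -/(bailey_factor r) bailey_factorE; ring.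
by apply: summable_nat => n m lt_mn; rewrite /t coef_term.
Qed.

(** The unit Bailey pair. The partial sums up to r < m telescope to a multiple of
    invfac_pred (n + 1 - m), which vanishes for m = n + 1. *)
Lemma bailey_beta_unit n :
  bailey_beta (fun r => (-1) ^+ r * q ^+ 'C(r, 2)) n = (n == 0)%:R.
Proof.
case: n => [|n].
  rewrite /bailey_beta big_ord1 /bailey_kernel /= /invfac /qpoch big_ord0 big_ord1.
  by rewrite bin0n !expr0 !mulr1 invr1 mul1r expr1 divrr // fps_unit1.
have u : (1 - q ^+ n.+1) \is a GRing.unit.
  by apply/fps_unit1/coef_1B0; rewrite coef_fpsXn.
apply: (mulrI u); rewrite mulr0 /bailey_beta.
have tele m : (m <= n.+2)%N -> (1 - q ^+ n.+1) *
    (\sum_(r < m) (1 - q ^+ r.*2.+1) * ((-1) ^+ r * q ^+ 'C(r, 2)) * dd n.+1 r) =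
    - ((-1) ^+ m * q ^+ 'C(m, 2) * (1 - q ^+ m) * (ipred (n.+2 - m) * ip (n.+1 + m))).
  elim: m => [|m IHm] lem.
    by rewrite big_ord0 mulr0 expr0 subrr mulr0 mul0r oppr0.
  rewrite big_ord_recr /= mulrDr {}IHm ?(ltnW lem) // /bailey_kernel.
  move: lem; rewrite ltnS => /subnK; set a := (n.+1 - m)%N => <-.
  have -> : ((a + m).+1 - m = a.+1)%N by lia.
  have -> : ((a + m).+1 - m.+1 = a)%N by lia.
  have -> : (a + m + m.+1 = (a + m + m).+1)%N by lia.
  rewrite /= ipredE (ipE (a + m + m)) binS bin1 -!addnn !(exprS, exprD).
  by ring.
by rewrite tele // subnn /= mul0r mulr0 oppr0.
Qed.

(** Its closed form is q^(r (3 r + 1) / 2) sum_(|j| <= r) (-1)^j q^(-j^2), whose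
    negative powers of q the recurrence avoids. *)
Fixpoint hecke_alpha (r : nat) : fps int :=
  if r is s.+1 then
    q ^+ (3 * s + 2) * hecke_alpha s + 2 * (-1) ^+ r * q ^+ 'C(r.+1, 2)
  else 1.

(** By the recurrence, each summand is a difference plus a multiple of
    (-1)^r q^(r (r + 1) / 2), and these multiples telescope in their turn. The
    factor 1 - q^(n + 1) clears the denominator of the second telescoping. *)
Lemma bailey_beta_heckeS n :
  (1 + q ^+ n.+1) * bailey_beta hecke_alpha n.+1 = bailey_beta hecke_alpha n.
Proof.
have u : (1 - q ^+ n.+1) \is a GRing.unit.
  by apply/fps_unit1/coef_1B0; rewrite coef_fpsXn.
apply/eqP; rewrite -subr_eq0; apply/eqP; apply: (mulrI u); rewrite mulr0 /bailey_beta.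
have -> : \sum_(r < n.+1) (1 - q ^+ r.*2.+1) * hecke_alpha r * dd n r =
    \sum_(r < n.+2) (1 - q ^+ r.*2.+1) * hecke_alpha r * dd n r.
  by rewrite [RHS]big_ord_recr /= bailey_kernel_gt // mulr0 addr0.
rewrite mulr_sumr -sumrB.
have tele m : (m <= n.+2)%N -> (1 - q ^+ n.+1) *
    (\sum_(r < m) ((1 + q ^+ n.+1) * ((1 - q ^+ r.*2.+1) * hecke_alpha r * dd n.+1 r) -
                   (1 - q ^+ r.*2.+1) * hecke_alpha r * dd n r)) =
    2 * (-1) ^+ m * q ^+ n.+1 * q ^+ 'C(m.+1, 2) * (ipred (n.+1 - m) * ip (n.+1 + m))
    - (1 - q ^+ n.+1) * hecke_alpha m * (q ^+ n.+1 + q ^+ (n.+1 - m)) *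
      (ipred (n.+2 - m) * ip (n.+1 + m)).
  elim: m => [|m IHm] lem.
    rewrite big_ord0 mulr0 !subn0 addn0 bin_small // expr0 /= ipE /= !exprS.
    ring.
  rewrite big_ord_recr /= mulrDr {}IHm ?(ltnW lem) // /bailey_kernel.
  move: lem; rewrite ltnS => /subnK; move: (n.+1 - m)%N => a an.
  have -> : (n + m = (a + m + m).-1)%N by lia.
  rewrite -an.
  have -> : ((a + m).+1 - m.+1 = a)%N by lia.
  have -> : (a + m - m.+1 = a.-1)%N by lia.
  have -> : ((a + m).+1 - m = a.+1)%N by lia.
  have -> : (a + m + m.+1 = (a + m + m).+1)%N by lia.
  rewrite prednK; last by lia.
  have -> : 'C(m.+2, 2) = ('C(m.+1, 2) + m.+1)%N by rewrite binS bin1 addnC.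
  clear an; case: a => [|a] /=.
    rewrite (ipE (0 + m + m)) !add0n -!addnn !mulSn !(exprS, exprD).
    by ring.
  rewrite !ipredE (ipE a) (ipE (a.+1 + m + m)).
  rewrite -!addnn !mulSn mul0n !addSn !addnS !addn0 !(exprS, exprD).
  by ring.
by rewrite tele // subnn /= (_ : n.+1 - n.+2 = 0)%N /= ?mul0r ?mulr0 ?subr0 //; lia.
Qed.

Lemma bailey_beta_hecke n : bailey_beta hecke_alpha n = (qpoch (- q) q n)^-1.
Proof.
have u m : qpoch (- q) q m \is a GRing.unit := qpoch_Nq_unit m.
apply: (mulrI (u n)); rewrite divrr //.
elim: n => [|n IHn].
  rewrite /bailey_beta big_ord1 /bailey_kernel /= /invfac /qpoch !big_ord0 big_ord1.
  by rewrite !expr0 !mulr1 invr1 !mul1r expr1 divrr // fps_unit1.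
rewrite {1}/qpoch big_ord_recr /= -/(qpoch (- q) q n) mulNr opprK -exprS -mulrA.
by rewrite bailey_beta_heckeS.
Qed.

(** Both sides are compared through the factor of the Bailey transform: the unit
    pair says that its product with psi(q) is 1. *)
Lemma lambda_hecke :
  lambda * fps_sum (fun r : nat => q ^+ 'C(r.+1, 2)) =
  fps_sum (fun r => (- q) ^+ r * hecke_alpha r).
Proof.
have unit_pair : 1 = bailey_factor 0 * fps_sum (fun r : nat => q ^+ 'C(r.+1, 2)).
  have := bailey_transform (fun r => (-1) ^+ r * q ^+ 'C(r, 2)).
  rewrite (@fps_sum_seq _ _ [:: 0%N]) //; last first.
    by case=> // n _; rewrite bailey_beta_unit mulr0.
  rewrite big_seq1 bailey_beta_unit /weight /qpoch big_ord0 !mulr1 => ->.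
  congr (_ * _); apply: eq_fps_sum => r; rewrite binS bin1 (exprNn q) exprD.
  by rewrite mulrACA -expr2 sqrr_sign mul1r mulrC.
have -> : lambda = bailey_factor 0 * fps_sum (fun r => (- q) ^+ r * hecke_alpha r).
  rewrite -bailey_transform -fps_series_sum; last by move=> i n; apply: coef_weightM.
  rewrite /lambda; congr fps_series; apply/funext => n.
  by rewrite bailey_beta_hecke /lambda_term /weight (exprNn q); ring.
by rewrite mulrAC -unit_pair mul1r.
Qed.

End Bailey.

(** * Monomials with integer exponents and theta series *)

(** A power of q with an integer exponent; it is 0 for a negative exponent. *)
Definition qpow (z : int) : fps int := if z is Posz n then q ^+ n else 0.

Definition sgnz (z : int) : fps int := (-1) ^+ `|z|%N.

Definition tri (n : int) : int := ((n * (n + 1)) %/ 2)%Z.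

Lemma coef_qpow z n : coef (qpow z) n = (n%:Z == z)%:R.
Proof. by case: z => m; [rewrite /= coef_fpsXn eqz_nat|]. Qed.

Lemma qpow0 : qpow 0 = 1. Proof. by []. Qed.

Lemma qpow_nat n : qpow n%:Z = q ^+ n. Proof. by []. Qed.

Lemma qpowD a b : 0 <= a -> 0 <= b -> qpow (a + b) = qpow a * qpow b.
Proof. by case: a b => // a [] // b _ _; rewrite -PoszD /= exprD. Qed.

Lemma sgnzD a b : sgnz (a + b) = sgnz a * sgnz b.
Proof. by rewrite /sgnz -exprD -signr_odd -[RHS]signr_odd; congr (_ ^+ _); lia. Qed.

Lemma sgnzN a : sgnz (- a) = sgnz a.
Proof. by rewrite /sgnz abszN. Qed.

Lemma sgnz_nat n : sgnz n%:Z = (-1) ^+ n. Proof. by []. Qed.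

Lemma sgnz_dbl a : sgnz (2 * a) = 1.
Proof. by rewrite /sgnz -signr_odd (_ : odd _ = false) ?expr0 //; lia. Qed.

Lemma sgnz_sqr a : sgnz a * sgnz a = 1.
Proof. by rewrite -sgnzD -(sgnz_dbl a); congr sgnz; ring. Qed.

Lemma sgnz_opp1 a : sgnz (- 1 - a) = - sgnz a.
Proof.
have -> : - 1 - a = a - 1 + 2 * (- a) by ring.
by rewrite 2!sgnzD sgnz_dbl mulr1 [sgnz (- 1)]expr1 mulrN1.
Qed.

Lemma triE n : 2 * tri n = n * (n + 1).
Proof.
rewrite mulrC divzK //; apply/dvdz_mod0P.
have : (n %% 2)%Z = 0 \/ (n %% 2)%Z = 1 by lia.
by case=> h; rewrite -modzMm -[((n + 1) %% 2)%Z]modzDml h.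
Qed.

Lemma triD a b : tri (a + b) = tri a + tri b + a * b.
Proof.
have := triE (a + b); have := triE a; have := triE b.
move: (tri _) (tri _) (tri _) => x y z; nia.
Qed.

Lemma triN a : tri (- a) = tri a - a.
Proof. by have := triE (- a); have := triE a; lia. Qed.

Lemma triS a : tri (a + 1) = tri a + a + 1.
Proof. by rewrite triD mulr1 -addrA [1 + _]addrC addrA (addrC (tri a + a)) addrC. Qed.

Lemma tri_opp a : tri (- 1 - a) = tri a.
Proof. by have := triE (- 1 - a); have := triE a; lia. Qed.

Lemma tri_ge0 a : 0 <= tri a.
Proof. by have := triE a; nia. Qed.

Lemma tri_ge a : `|a| <= tri a + 1.
Proof.
have := triE a; have : 0 <= (2 * a - 1) * (2 * a - 1) by rewrite -expr2 sqr_ge0.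
have : 0 <= (2 * a + 3) * (2 * a + 3) by rewrite -expr2 sqr_ge0.
by case: (lerP 0 a) => a0; nia.
Qed.

Lemma tri_nat (n : nat) : tri n = 'C(n.+1, 2).
Proof.
elim: n => [|n IHn]; first by [].
have -> : n.+1%:Z = n%:Z + 1 by lia.
by rewrite triS IHn (binS n.+1) bin1 PoszD; lia.
Qed.

Lemma summable_qpow (c : nat) (w : int -> fps int) (e : int -> int) :
  (forall z, `|z| <= e z + c%:Z) -> summable (fun z => w z * qpow (e z)).
Proof.
move=> le_e; apply: summableM => n; exists (int_range (n + c)) => z m le_mn.
rewrite coef_qpow mem_int_range; case: eqP => // mz _.
by have := le_e z; lia.
Qed.

Arguments tri : simpl never.
Arguments qpow : simpl never.

Lemma fps_sum_antisym (h : int -> int) (F : int -> fps int) :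
  involutive h -> summable F -> (forall z, F (h z) = - F z) -> fps_sum F = 0.
Proof.
move=> hK sF Fh; have : fps_sum F = - fps_sum F.
  by rewrite {1}(fps_sum_bij F hK hK) -fps_sumN //; apply: eq_fps_sum => z /=.
move=> /fpsP FN; apply/fpsP => n; have := FN n; rewrite fps_coefN fps_coef0.
by move: (coef _ _) => x; lia.
Qed.

(** This is the theta function phi(-q^m) in the usual notation. *)
Definition phi (m : nat) : fps int :=
  fps_sum (fun k : int => sgnz k * qpow (m%:Z * k ^+ 2)).

Definition psi (m : nat) : fps int :=
  fps_sum (fun n : nat => qpow (m%:Z * tri n%:Z)).

Definition jac (m : nat) : fps int :=
  fps_sum (fun n : nat => sgnz n * (2 * n%:Z + 1)%:~R * qpow (m%:Z * tri n%:Z)).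

(** The exponents are the pentagonal numbers n (3 n - 1) / 2. *)
Definition penta : fps int :=
  fps_sum (fun z : int => sgnz z * qpow (3 * tri z - 2 * z)).

(** * Dilation and sections of power series *)

Definition dil (m : nat) (F : fps int) : fps int :=
  Fps (fun n => if (m %| n)%N then coef F (n %/ m)%N else 0).

(** With dil m F = F(q^m), any F is the sum over r < m of
    q^r (dil m (sect m r F)). *)
Definition sect (m r : nat) (F : fps int) : fps int :=
  Fps (fun n => coef F (m * n + r)%N).

Lemma coef_dil m F n :
  coef (dil m F) n = if (m %| n)%N then coef F (n %/ m)%N else 0.
Proof. by []. Qed.

Lemma coef_sect m r F n : coef (sect m r F) n = coef F (m * n + r)%N.
Proof. by []. Qed.

Lemma sect_sum m r (I : choiceType) (F : I -> fps int) :
  sect m r (fps_sum F) = fps_sum (fun i => sect m r (F i)).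
Proof. by []. Qed.

Lemma sectD m r F G : sect m r (F + G) = sect m r F + sect m r G.
Proof. by []. Qed.

Lemma dil_sum m (I : choiceType) (F : I -> fps int) :
  dil m (fps_sum F) = fps_sum (fun i => dil m (F i)).
Proof.
apply/fpsP => n; rewrite coef_dil /fps_sum /coef; case: ifP => [mn|mn].
  by apply: eq_fsbigr => i _; rewrite mn.
by rewrite fsbig1 // => i _; rewrite mn.
Qed.

(** Series in q^m are constants for the extraction of the exponents r mod m. *)
Lemma sect_dilM m r F G : (r < m)%N ->
  sect m r (dil m F * G) = F * sect m r G.
Proof.
move=> lt_rm; have m_gt0 : (0 < m)%N by apply: leq_ltn_trans lt_rm.
apply/fpsP => n; rewrite coef_sect !fps_coefM.
transitivity (\sum_(i < (m * n + r).+1) \sum_(j < n.+1)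
    if i == (m * j)%N :> nat then coef F j * coef G (m * n + r - m * j) else 0).
  apply: eq_bigr => -[i /= lt_i] _; rewrite coef_dil.
  case: ifP => [/dvdnP[j ij]|mi].
    have lt_jn : (j < n.+1)%N.
      rewrite ltnS leqNgt; apply/negP => lt_nj.
      have : (m * n.+1 <= m * j)%N by rewrite leq_mul2l lt_nj orbT.
      by rewrite mulnS [(m * j)%N]mulnC -ij; lia.
    rewrite (bigD1 (Ordinal lt_jn)) //= ij mulnK // (mulnC j) eqxx big1 ?addr0 //.
    move=> k /negP kj; case: eqP => // /eqP; rewrite eqn_pmul2l // => /eqP jk.
    by case: kj; apply/eqP/val_inj.
  rewrite mul0r big1 // => j _; case: eqP => // ij.
  by rewrite ij dvdn_mulr in mi.
rewrite exchange_big; apply: eq_bigr => -[j /= lt_j] _.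
have lt_mj : (m * j < (m * n + r).+1)%N.
  by rewrite ltnS (leq_trans _ (leq_addr _ _)) // leq_mul2l -ltnS lt_j orbT.
rewrite (bigD1 (Ordinal lt_mj)) //= eqxx big1 ?addr0 => [|i /negP ij].
  rewrite coef_sect; congr (_ * coef G _).
  by rewrite mulnBr addnBAC // leq_mul2l -ltnS lt_j orbT.
by case: eqP => // ji; case: ij; apply/eqP/val_inj.
Qed.


Lemma sect_qpow0 m c : (0 < m)%N -> (m %| c)%Z = false -> sect m 0 (qpow c) = 0.
Proof.
move=> m_gt0 mc; apply/fpsP => n; rewrite coef_sect addn0 coef_qpow fps_coef0.
by case: eqP => // cE; rewrite -cE PoszM dvdz_mulr in mc.
Qed.

Lemma sect_dil m F : (0 < m)%N -> sect m 0 (dil m F) = F.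
Proof.
move=> m_gt0; apply/fpsP => n; rewrite coef_sect addn0 coef_dil dvdn_mulr //.
by rewrite mulKn.
Qed.

Lemma dil_qpow m c : (0 < m)%N -> dil m (qpow c) = qpow (m%:Z * c).
Proof.
move=> m_gt0; apply/fpsP => n; rewrite coef_dil !coef_qpow.
case: ifP => [/dvdnP[j ->]|mn].
  rewrite mulnK // PoszM mulrC (inj_eq (mulfI _)) //.
  by rewrite eqz_nat -lt0n.
case: eqP => // cE; case: c cE => c; last by nia.
by rewrite -PoszM => -[nE]; rewrite nE dvdn_mulr in mn.
Qed.

Lemma coef_intM (a : int) F n : coef (a%:~R * F) n = a * coef F n.
Proof.
have cE k : coef (F *+ k) n = k%:Z * coef F n.
  elim: k => [|k IHk]; first by rewrite mul0r.
  by rewrite mulrS fps_coefD IHk; lia.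
by rewrite mulrzl; case: a => k; rewrite /intmul ?fps_coefN cE //; lia.
Qed.

Lemma dil_intM m (a : int) F : dil m (a%:~R * F) = a%:~R * dil m F.
Proof.
apply/fpsP => n; rewrite coef_intM !coef_dil coef_intM.
by case: ifP; rewrite ?mulr0.
Qed.

Lemma sect_intM m r (a : int) F : sect m r (a%:~R * F) = a%:~R * sect m r F.
Proof. by apply/fpsP => n; rewrite coef_intM !coef_sect coef_intM. Qed.

Lemma dil1B m n : (0 < m)%N -> dil m (1 - q ^+ n) = 1 - q ^+ (m * n).
Proof.
move=> m_gt0; have d1 : dil m 1 = 1 by rewrite -[1]/(qpow 0) dil_qpow // mulr0.
transitivity (dil m 1 - dil m (qpow n)); last by rewrite d1 dil_qpow // -PoszM.
by apply/fpsP => k; rewrite fps_coefB !coef_dil; case: ifP; rewrite ?subr0.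
Qed.

(** * The Hecke-type double sum times a theta series *)

Lemma big_int_rangeS (F : int -> fps int) n :
  \sum_(j <- int_range n.+1) F j =
  F n.+1%:Z + F (- n.+1%:Z) + \sum_(j <- int_range n) F j.
Proof.
have := mem_int_range n.+1; have := mem_int_range n.
have := int_range_uniq n.+1; have := int_range_uniq n.
move: (int_range n) (int_range n.+1) => s t s_uniq t_uniq sP tP.
have pe : perm_eq t (n.+1%:Z :: - n.+1%:Z :: s).
  apply: uniq_perm => // [|z]; last by rewrite !inE sP tP; lia.
  by rewrite /= s_uniq inE !sP andbT; lia.
by rewrite (perm_big _ pe) !big_cons /= addrA.
Qed.

Lemma tri_ge_sqr (n : nat) (j : int) : (`|j| <= n)%N -> 0 <= 3 * tri n - j ^+ 2.
Proof. by move=> le_jn; have := triE n; rewrite expr2; nia. Qed.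

(** The factor q^r completes the exponent r (3 r + 1) / 2 to 3 T_r, and makes all
    exponents nonnegative. *)
Lemma hecke_alphaE r :
  q ^+ r * hecke_alpha r = \sum_(j <- int_range r) sgnz j * qpow (3 * tri r - j ^+ 2).
Proof.
elim: r => [|r IHr]; first by rewrite big_seq1 !mulr1.
have triSr : tri r.+1 = tri r + r%:Z + 1 by rewrite -triS; congr tri; lia.
rewrite big_int_rangeS.
have -> : \sum_(j <- int_range r) sgnz j * qpow (3 * tri r.+1 - j ^+ 2) =
    q ^+ (3 * r + 3) * \sum_(j <- int_range r) sgnz j * qpow (3 * tri r - j ^+ 2).
  rewrite mulr_sumr; apply: eq_big_seq => j; rewrite mem_int_range => le_jr.
  rewrite [RHS]mulrCA -[q ^+ _]/(qpow (3 * r + 3)%N) -qpowD //; last exact: tri_ge_sqr.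
  by congr (_ * qpow _); rewrite triSr PoszD PoszM; ring.
rewrite -IHr sgnzN sqrrN.
have -> : 3 * tri r.+1 - r.+1%:Z ^+ 2 = (r.+1 + 'C(r.+2, 2))%N%:Z.
  by rewrite PoszD -tri_nat; have := triE r.+1; rewrite expr2; lia.
have -> : q ^+ (3 * r + 3) = q ^+ (3 * r + 2) * q by rewrite -exprSr -addnS.
rewrite qpow_nat sgnz_nat /= (exprD q r.+1) (exprS q r).
by move: (q ^+ (3 * r + 2)) => x; ring.
Qed.

Lemma sgnz_int a : sgnz a = ((-1) ^+ `|a|%N)%:~R.
Proof. by rewrite /sgnz rmorphXn rmorphN1. Qed.

Definition hecke_term (nj : nat * int) : fps int :=
  if (`|nj.2| <= nj.1)%N then
    sgnz (nj.1%:Z + nj.2) * qpow (3 * tri nj.1 - nj.2 ^+ 2)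
  else 0.

Lemma coef_hecke_term n j m :
  coef (hecke_term (n, j)) m != 0 -> (`|j| <= n)%N && (n <= m)%N.
Proof.
rewrite /hecke_term /=; case: ifP => [le_jn|]; last by rewrite fps_coef0 eqxx.
rewrite sgnz_int coef_intM coef_qpow.
case: (m%:Z =P _) => [mE _|_]; last by rewrite /= mulr0 eqxx.
by rewrite /=; have := triE n; move: mE le_jn; rewrite expr2; nia.
Qed.

Lemma summable_hecke : summable hecke_term.
Proof.
apply: summable_pair => n; exists (iota 0 n.+1), (int_range n) => i j m le_mn.
move=> /coef_hecke_term/andP[le_ji le_im]; rewrite mem_iota mem_int_range.
by rewrite add0n ltnS !(leq_trans _ le_mn) // (leq_trans le_ji).
Qed.

Lemma hecke_sumE :
  fps_sum (fun r => (- q) ^+ r * hecke_alpha r) = fps_sum hecke_term.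
Proof.
rewrite fps_sum_pair; last exact: summable_hecke.
apply: eq_fps_sum => r; rewrite (exprNn q) -mulrA hecke_alphaE.
rewrite (@fps_sum_seq _ _ (int_range r)) ?int_range_uniq //; last first.
  by move=> j; rewrite mem_int_range /hecke_term /= => /negbTE ->.
rewrite mulr_sumr; apply: eq_big_seq => j; rewrite mem_int_range => le_jr.
by rewrite /hecke_term /= le_jr sgnzD sgnz_nat mulrA.
Qed.

(** After the change of variables k -> k - j, the terms of the triple sum with a
    given k make up a row. *)
Definition hecke_row_term (k : int) (nj : nat * int) : fps int :=
  if (`|nj.2| <= nj.1)%N then
    sgnz (nj.1%:Z + k) * qpow (3 * tri nj.1 + k ^+ 2 - 2 * k * nj.2)
  else 0.

Definition hecke_row (k : int) : fps int := fps_sum (hecke_row_term k).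

Lemma summable_phi m : (0 < m)%N ->
  summable (fun k : int => sgnz k * qpow (m%:Z * k ^+ 2)).
Proof. by move=> m_gt0; apply: (@summable_qpow 0) => z; rewrite expr2; nia. Qed.

(** Since -j^2 + (k - j)^2 = k^2 - 2 k j, the square of j disappears. *)
Lemma hecke_phi :
  summable hecke_row /\ fps_sum hecke_term * phi 1 = fps_sum hecke_row.
Proof.
have sh := summable_hecke; have sp := summable_phi (ltn0Sn 0).
pose F (x : (nat * int) * int) := hecke_term x.1 * (sgnz x.2 * qpow (1%N%:Z * x.2 ^+ 2)).
pose h (x : nat * int * int) := (x.1, x.2 - x.1.2).
pose g (x : nat * int * int) := (x.1, x.2 + x.1.2).
have hK : cancel h g by move=> [[n j] k]; rewrite /h /g /= subrK.
have gK : cancel g h by move=> [[n j] k]; rewrite /h /g /= addrK.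
have sF : summable F := summable_mul sh sp.
have Fh : F \o h =1 fun x => hecke_row_term x.2 x.1.
  move=> [[n j] k]; rewrite /F /h /= /hecke_term /hecke_row_term /=.
  case: ifP => le_jn; last by rewrite mul0r.
  rewrite mul1r mulrACA -sgnzD -qpowD ?tri_ge_sqr ?sqr_ge0 //.
  by congr (sgnz _ * qpow _); ring.
have sR : summable (fun x : (nat * int) * int => hecke_row_term x.2 x.1).
  by apply: eq_summable Fh _; apply: summable_comp sF; apply: can_inj hK.
split; first by apply: summable_fst (summable_swap sR).
rewrite fps_sumM // (fps_sum_bij _ hK gK) (eq_fps_sum Fh) fps_sum_pair //.
by rewrite fps_sum_exchange.
Qed.

Lemma summable_row_term k : summable (hecke_row_term k).
Proof.
apply: summable_pair => n; exists (iota 0 n.+1), (int_range n) => i j m le_mn.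
rewrite mem_iota mem_int_range add0n ltnS /hecke_row_term /=.
case: ifP => [le_ji|]; last by rewrite fps_coef0 eqxx.
rewrite sgnz_int coef_intM coef_qpow; case: (m%:Z =P _) => [mE _|_]; last first.
  by rewrite /= mulr0 eqxx.
have := triE i; have : 0 <= (k - j) * (k - j) by rewrite -expr2 sqr_ge0.
move: mE; rewrite expr2 => mE sq t2.
have le_im : (i <= m)%N by nia.
by rewrite (leq_trans le_im) //= (leq_trans le_ji) // (leq_trans le_im).
Qed.

Lemma hecke_row_inner k n :
  fps_sum (fun j => hecke_row_term k (n, j)) = sgnz (n%:Z + k) *
    \sum_(j <- int_range n) qpow (3 * tri n + k ^+ 2 - 2 * k * j).
Proof.
rewrite (@fps_sum_seq _ _ (int_range n)) ?int_range_uniq //; last first.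
  by move=> j; rewrite mem_int_range /hecke_row_term /= => /negbTE ->.
rewrite mulr_sumr; apply: eq_big_seq => j; rewrite mem_int_range => le_jn.
by rewrite /hecke_row_term /= le_jn.
Qed.

Lemma hecke_rowE k :
  let F (n : nat) := sgnz (n%:Z + k) *
    \sum_(j <- int_range n) qpow (3 * tri n + k ^+ 2 - 2 * k * j) in
  summable F /\ hecke_row k = fps_sum F.
Proof.
move=> F; have sT := summable_row_term k.
split; last by rewrite /hecke_row fps_sum_pair //; apply/eq_fps_sum/hecke_row_inner.
exact: eq_summable (hecke_row_inner k) (summable_fst sT).
Qed.

Lemma hecke_row0 : hecke_row 0 = jac 3.
Proof.
have [_ ->] := hecke_rowE 0; apply: eq_fps_sum => n; rewrite addr0 -mulrA; congr (_ * _).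
under eq_bigr do rewrite mulr0 mul0r subr0 addr0.
rewrite big_const_seq count_predT size_map size_iota iter_addr_0 mulrzl.
by have -> : 2 * n%:Z + 1 = (n + n).+1%:Z by lia.
Qed.

Lemma hecke_rowN k : hecke_row (- k) = hecke_row k.
Proof.
pose h (x : nat * int) := (x.1, - x.2).
have hK : involutive h by move=> [n j]; rewrite /h /= opprK.
rewrite /hecke_row (fps_sum_bij _ hK hK); apply: eq_fps_sum => -[n j].
rewrite /hecke_row_term /= abszN sgnzD sgnzN -sgnzD sqrrN.
by have -> : 2 * - k * - j = 2 * k * j by ring.
Qed.

(** For k > 0 the sum over |j| <= n is geometric; the two families of boundary
    terms that it leaves are the two halves of a theta series. *)
Lemma hecke_row_geom (k : nat) : (0 < k)%N ->
  (1 - q ^+ (2 * k)) * hecke_row k =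
  fps_sum (fun z : int => sgnz (z + k%:Z) *
    qpow (3 * tri z + k%:Z ^+ 2 - 2 * k%:Z * z)).
Proof.
move=> k_gt0; rewrite [RHS]fps_sum_int; last first.
  apply: (@summable_qpow 2) => z; have := triE z.
  have : 0 <= (k%:Z - z) * (k%:Z - z) by rewrite -expr2 sqr_ge0.
  by rewrite expr2; case: (lerP 0 z) => z0; nia.
have [sF ->] := hecke_rowE k; rewrite fps_mulr_sumr //.
apply: eq_fps_sum => n; rewrite mulrCA.
have -> : sgnz (-1 - n%:Z + k%:Z) = - sgnz (n%:Z + k%:Z).
  by rewrite !(sgnzD _ k) sgnz_opp1 mulNr.
rewrite mulNr -mulrBr tri_opp; congr (_ * _).
pose f (j : int) := qpow (3 * tri n + k%:Z ^+ 2 - 2 * k%:Z * j).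
rewrite mulr_sumr (eq_big_seq (fun j => f j - f (j - 1))); last first.
  move=> j; rewrite mem_int_range => le_jn; rewrite mulrBl mul1r /f; congr (_ - _).
  rewrite -[q ^+ _]/(qpow (2 * k)%N) -qpowD //; last first.
    have := tri_ge_sqr le_jn; have : 0 <= (k%:Z - j) * (k%:Z - j) by rewrite -expr2 sqr_ge0.
    by rewrite !expr2; lia.
  by congr qpow; rewrite PoszM; ring.
rewrite big_map.
pose g (i : nat) := f (i%:Z - n%:Z - 1).
rewrite (eq_bigr (fun i => g i.+1 - g i)); last first.
  by move=> i _; rewrite /g; congr (f _ - _); lia.
have := telescope_sumr g (leq0n (n + n).+1); rewrite /index_iota subn0 => ->.
by rewrite /g /f; congr (qpow _ - qpow _); lia.
Qed.

Lemma summable_penta : summable (fun z : int => sgnz z * qpow (3 * tri z - 2 * z)).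
Proof.
apply: (@summable_qpow 2) => z; have := triE z.
by case: (lerP 0 z) => z0; nia.
Qed.

Lemma penta_exp_ge0 z : 0 <= 3 * tri z - 2 * z.
Proof. by have := triE z; nia. Qed.

Lemma penta_shift (a : int) (c : nat) :
  ((-1) ^+ `|a|%N)%:~R * (q ^+ c * penta) =
  fps_sum (fun z : int => sgnz (z + a) * qpow (3 * tri z - 2 * z + c%:Z)).
Proof.
rewrite -sgnz_int /penta fps_mulr_sumr; last exact: summable_penta.
rewrite fps_mulr_sumr; last by apply: summableM; exact: summable_penta.
apply: eq_fps_sum => z; rewrite sgnzD [in RHS]qpowD ?penta_exp_ge0 //.
by rewrite qpow_nat; ring.
Qed.

(** According to k mod 3, this theta series vanishes by antisymmetry or is a
    shift of the pentagonal series by an odd exponent. *)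
Lemma hecke_row_penta (k : nat) : (0 < k)%N ->
  exists (s : int) (c : nat), odd c /\
    (1 - q ^+ (2 * k)) * hecke_row k = s%:~R * (q ^+ c * penta).
Proof.
move=> k_gt0; rewrite hecke_row_geom //.
pose F (z : int) := sgnz (z + k%:Z) * qpow (3 * tri z + k%:Z ^+ 2 - 2 * k%:Z * z).
have sF : summable F.
  apply: (@summable_qpow 2) => z; have := triE z.
  have : 0 <= (k%:Z - z) * (k%:Z - z) by rewrite -expr2 sqr_ge0.
  by rewrite expr2; case: (lerP 0 z) => z0; nia.
pose m := (k %/ 3)%N; pose h (a : int) (z : int) := z + a.
have hK a : cancel (h a) (h (- a)) by move=> z; rewrite /h addrK.
have gK a : cancel (h (- a)) (h a) by move=> z; rewrite /h subrK.
rewrite -/F; have : (k %% 3 = 0 \/ k %% 3 = 1 \/ k %% 3 = 2)%N by lia.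
case=> [k3|[k3|k3]].
- have kE : k%:Z = 3 * m%:Z by rewrite /m; lia.
  exists 0, 1%N; split=> //; rewrite mul0r (fps_sum_bij _ (hK (2 * m%:Z)) (gK _)).
  apply: (@fps_sum_antisym (fun z => -1 - z)).
  + by move=> z; ring.
  + by apply: summable_comp sF; apply: can_inj (hK _).
  move=> z; rewrite /F /h /= kE.
  have -> : -1 - z + 2 * m%:Z + 3 * m%:Z = z + 2 * m%:Z + 3 * m%:Z - 1 + 2 * (- z) by ring.
  rewrite (sgnzD _ (2 * _)) (sgnzD _ (- 1)) sgnz_dbl mulr1 [sgnz (- 1)]expr1 mulrN1 mulNr.
  congr (- (_ * qpow _)).
  by rewrite (triD z) (triD (-1 - z)) tri_opp; ring.
- have kE : k%:Z = 3 * m%:Z + 1 by rewrite /m; lia.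
  have [c cE] : exists c : nat, c%:Z = 6 * tri m + 2 * m%:Z + 1.
    by exists (absz (6 * tri m + 2 * m%:Z + 1)); have := tri_ge0 m; lia.
  exists ((-1) ^+ (absz (5 * m%:Z + 1))), c; split; first by lia.
  rewrite penta_shift (fps_sum_bij _ (hK (2 * m%:Z)) (gK _)).
  apply: eq_fps_sum => z; rewrite /F /h /= kE cE.
  congr (sgnz _ * qpow _); first by ring.
  by have := triE m; have := triE (2 * m%:Z); rewrite triD expr2; nia.
have kE : k%:Z = 3 * m%:Z + 2 by rewrite /m; lia.
have [c cE] : exists c : nat, c%:Z = 6 * tri m + 4 * m%:Z + 3.
  by exists (absz (6 * tri m + 4 * m%:Z + 3)); have := tri_ge0 m; lia.
exists ((-1) ^+ (absz (5 * m%:Z + 3))), c; split; first by lia.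
rewrite penta_shift (fps_sum_bij _ (hK (2 * m%:Z + 1)) (gK _)).
rewrite [RHS](fps_sum_bij _ (@opprK int) (@opprK int)).
apply: eq_fps_sum => z; rewrite /F /h /= kE cE (sgnzD (- z)) sgnzN -sgnzD.
congr (sgnz _ * qpow _); first by ring.
have := triE m; have := triE (2 * m%:Z + 1).
by rewrite triN triD expr2; nia.
Qed.

(** An odd power of q times a series in q^2 has no even part. *)
Lemma sect_psi_hecke_row (G : fps int) (k : int) : psi 1 * penta = dil 2 G ->
  k != 0 -> sect 2 0 (psi 1 * hecke_row k) = 0.
Proof.
move=> psi_penta k0.
have [n [n_gt0 ->]] : exists n : nat, (0 < n)%N /\ hecke_row k = hecke_row n.
  exists `|k|%N; split; first by lia.
  have [kE|kE] : k = `|k|%N%:Z \/ k = - `|k|%N%:Z by lia.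
    by rewrite {1}kE.
  by rewrite {1}kE hecke_rowN.
have [s [c [c_odd rowE]]] := hecke_row_penta n_gt0.
have u : (1 - q ^+ n) \is a GRing.unit.
  by apply/fps_unit1/coef_1B0; rewrite coef_fpsXn; case: n n_gt0 {rowE}.
apply: (mulrI u); rewrite mulr0 -sect_dilM // dil1B // mulrCA rowE.
have -> : psi 1 * (s%:~R * (q ^+ c * penta)) = s%:~R * (dil 2 G * qpow c).
  by rewrite -psi_penta qpow_nat; ring.
rewrite sect_intM sect_dilM // sect_qpow0 ?mulr0 //.
by apply/negbTE; rewrite dvdzE !absz_nat dvdn2 c_odd.
Qed.

Lemma even_part_psi_hecke (G : fps int) : psi 1 * penta = dil 2 G ->
  sect 2 0 (psi 1 * (fps_sum hecke_term * phi 1)) = sect 2 0 (psi 1 * jac 3).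
Proof.
move=> psi_penta; have [sR ->] := hecke_phi.
rewrite fps_mulr_sumr // sect_sum (@fps_sum_seq _ _ [:: 0]) //; last first.
  by move=> k; rewrite inE => /(sect_psi_hecke_row psi_penta).
by rewrite big_seq1 hecke_row0.
Qed.

(** * The even part of psi(q) J(q^3) *)

Lemma sect_qpow2 a : sect 2 0 (qpow (2 * a)) = qpow a.
Proof. by rewrite -(@dil_qpow 2) // sect_dil. Qed.

Lemma fps_mulz_inj (a : int) (F G : fps int) : a != 0 ->
  a%:~R * F = a%:~R * G -> F = G.
Proof.
move=> a0 /fpsP FG; apply/fpsP => n; have := FG n.
by rewrite !coef_intM => /(mulfI a0).
Qed.

Lemma summable_tri (m : nat) (w : int -> fps int) : (0 < m)%N ->
  summable (fun z : int => w z * qpow (m%:Z * tri z)).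
Proof.
move=> m_gt0; apply: (@summable_qpow 1) => z; apply: le_trans (tri_ge z) _.
by have := tri_ge0 z; nia.
Qed.

Lemma summable_sect m r (I : choiceType) (F : I -> fps int) :
  summable F -> summable (fun i => sect m r (F i)).
Proof.
move=> sF n; have [s sP] := sF (m * n + r)%N; exists s => i k le_kn.
by rewrite coef_sect; apply: sP; rewrite leq_add2r leq_mul2l le_kn orbT.
Qed.

Lemma psi_bilateral m : (0 < m)%N ->
  2%:~R * psi m = fps_sum (fun z : int => qpow (m%:Z * tri z)).
Proof.
move=> m_gt0.
have sF : summable (fun z : int => qpow (m%:Z * tri z)).
  apply: eq_summable (summable_tri (fun=> 1) m_gt0) => z; exact: mul1r.
have sN : summable (fun n : nat => qpow (m%:Z * tri n%:Z)).
  by apply: (@summable_comp _ _ Posz) sF => // x y [].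
rewrite fps_sum_int // fps_mulr_sumr //; apply: eq_fps_sum => n.
by rewrite tri_opp; ring.
Qed.

Lemma jac_bilateral m : (0 < m)%N -> 2%:~R * jac m =
  fps_sum (fun z : int => sgnz z * (2 * z + 1)%:~R * qpow (m%:Z * tri z)).
Proof.
move=> m_gt0.
have sF := summable_tri (fun z => sgnz z * (2 * z + 1)%:~R) m_gt0.
rewrite fps_sum_int // fps_mulr_sumr; last first.
  by apply: (@summable_comp _ _ Posz _ _ sF) => x y [].
apply: eq_fps_sum => n; rewrite tri_opp.
have -> : 2 * (- 1 - n%:Z) + 1 = - (2 * n%:Z + 1) by ring.
by rewrite sgnz_opp1 rmorphN /=; ring.
Qed.

(** Since 8 (T_m + 3 T_n) + 4 = (2 m + 1)^2 + 3 (2 n + 1)^2 is the norm of an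
    Eisenstein integer, it is unchanged by a multiplication by a unit. This is
    the substitution (m, n) = (a + 3 k, a - k): it turns the exponent into
    4 T_a + 6 k^2 and reaches the pairs with m = n mod 4, which are, together
    with their images under m -> -1 - m, all the pairs with an even exponent.
    The factor 2 n + 1 becomes 2 a + 1 - 2 k, whose part that is odd in k
    cancels. *)
Lemma even_part_psi_jac : sect 2 0 (psi 1 * jac 3) = jac 2 * phi 3.
Proof.
pose X (x : int * int) := sgnz x.2 * (2 * x.2 + 1)%:~R *
  sect 2 0 (qpow (tri x.1 + 3 * tri x.2)).
(* An even exponent requires 4 to divide (m - n) (m + n + 1), hence exactly one of
   the two factors, as they have different parities. *)
pose P (x : int * int) := (4 %| x.1 - x.2)%Z.
pose P' (x : int * int) := (4 %| x.1 + x.2 + 1)%Z.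
have sect_sgn (a b : int) F :
    sect 2 0 (sgnz a * b%:~R * F) = sgnz a * b%:~R * sect 2 0 F.
  by rewrite sgnz_int -rmorphM sect_intM.
have XsE (x : int * int) : sect 2 0 (1 * qpow (1%N%:Z * tri x.1) *
    (sgnz x.2 * (2 * x.2 + 1)%:~R * qpow (3%N%:Z * tri x.2))) = X x.
  rewrite /X !mul1r mulrCA sect_sgn qpowD ?tri_ge0 //.
  by have := tri_ge0 x.2; lia.
have s1 := @summable_tri 1 (fun=> 1) isT.
have s3 := @summable_tri 3 (fun z => sgnz z * (2 * z + 1)%:~R) isT.
have sX : summable X.
  by apply: eq_summable XsE _; apply: summable_sect; exact: (summable_mul s1 s3).
have XE : 4%:~R * sect 2 0 (psi 1 * jac 3) = fps_sum X.
  rewrite -sect_intM.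
  have -> : 4%:~R * (psi 1 * jac 3) = 2%:~R * psi 1 * (2%:~R * jac 3) by ring.
  rewrite psi_bilateral // jac_bilateral //.
  rewrite (eq_fps_sum (fun z => esym (mul1r (qpow (1%N%:Z * tri z))))).
  by rewrite fps_sumM // sect_sum (eq_fps_sum XsE).
have sub (Q : pred (int * int)) : summable (fun x => if Q x then X x else 0).
  move=> n; have [r rP] := sX n; exists r => x m le_mn.
  by case: ifP => _; [exact: rP | rewrite fps_coef0 eqxx].
have XP : fps_sum X = fps_sum (fun x => if P x then X x else 0) +
                      fps_sum (fun x => if P' x then X x else 0).
  rewrite -fps_sumD //; apply: eq_fps_sum => -[m n]; rewrite /P /P' /=.
  case: ifP => h1; case: ifP => h2; rewrite ?addr0 ?add0r //; first by lia.
  rewrite /X /= sect_qpow0 ?mulr0 //.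
  apply/negbTE/negP; have := triE m; have := triE n; move: (tri m) (tri n) => x y.
  have [a [i [mE i4]]] : exists a i, m = 4 * a + i /\ (i = 0 \/ i = 1 \/ i = 2 \/ i = 3).
    by exists (m %/ 4)%Z, (m %% 4)%Z; split; lia.
  have [b [j [nE j4]]] : exists b j, n = 4 * b + j /\ (j = 0 \/ j = 1 \/ j = 2 \/ j = 3).
    by exists (n %/ 4)%Z, (n %% 4)%Z; split; lia.
  move: h1 h2; rewrite {}mE {}nE.
  by case: i4 => [|[|[|]]] ->; case: j4 => [|[|[|]]] ->; lia.
have XP' : fps_sum (fun x => if P' x then X x else 0) =
           fps_sum (fun x => if P x then X x else 0).
  pose h (x : int * int) := (- 1 - x.1, x.2).
  have hK : involutive h by move=> [m n]; rewrite /h /=; congr (_, _); ring.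
  rewrite (fps_sum_bij _ hK hK); apply: eq_fps_sum => -[m n].
  rewrite /P /P' /X /h /= tri_opp; congr (if _ then _ else _).
  by apply/idP/idP; lia.
pose Y (x : int * int) := sgnz (x.1 + x.2) * (2 * x.1 + 1 - 2 * x.2)%:~R *
  (qpow (2 * tri x.1) * qpow (3 * x.2 ^+ 2)).
pose g (x : int * int) := (x.1 + 3 * x.2, x.1 - x.2).
have g_inj : injective g by move=> [a b] [c d]; rewrite /g /= => -[] *; congr (_, _); lia.
have gE : (fun x => if P x then X x else 0) \o g =1 Y.
  move=> [a k]; rewrite /g /P /X /Y /= ifT; last by lia.
  have -> : tri (a + 3 * k) + 3 * tri (a - k) = 2 * (2 * tri a + 3 * k ^+ 2).
    by have := triE (3 * k); have := triE k; rewrite !triD triN expr2; nia.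
  rewrite sect_qpow2 qpowD; last 2 first.
  - by have := tri_ge0 a; lia.
  - by rewrite expr2; nia.
  by rewrite sgnzD sgnzN -sgnzD; congr (_ * _%:~R * _); ring.
have XY : fps_sum (fun x => if P x then X x else 0) = fps_sum Y.
  rewrite (fps_sum_inj g_inj) ?(eq_fps_sum gE) // => -[m n] h.
  rewrite /P /=; case: ifP => // mn.
  by case: (h (n + ((m - n) %/ 4)%Z, ((m - n) %/ 4)%Z)); rewrite /g /=; congr (_, _); lia.
have sY : summable Y := (eq_summable gE (summable_comp g_inj (sub P))).
pose h (x : int * int) := (x.1, - x.2).
have hK : involutive h by move=> [m n]; rewrite /h /= opprK.
have Yh : fps_sum Y = fps_sum (Y \o h) := fps_sum_bij Y hK hK.
have YE : 2%:~R * fps_sum Y = 4%:~R * (jac 2 * phi 3).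
  have -> : 2%:~R * fps_sum Y = fps_sum Y + fps_sum (Y \o h) by rewrite -Yh; ring.
  rewrite -fps_sumD //; last by apply: summable_comp sY; apply: can_inj hK.
  have -> : 4%:~R * (jac 2 * phi 3) = 2%:~R * (2%:~R * jac 2 * phi 3) by ring.
  have s2 := @summable_tri 2 (fun z => sgnz z * (2 * z + 1)%:~R) isT.
  have sp := @summable_phi 3 isT.
  rewrite jac_bilateral // fps_sumM // fps_mulr_sumr; last exact: (summable_mul s2 sp).
  apply: eq_fps_sum => -[a k]; rewrite /Y /h /= sqrrN !sgnzD sgnzN.
  by rewrite !(rmorphD, rmorphN, rmorphM) /=; ring.
apply: (@fps_mulz_inj 4) => //; rewrite XE XP XP' XY.
by rewrite -YE; ring.
Qed.

(** * Convergent infinite products *)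

Section InfProd.
Variable R : comNzRingType.
Implicit Types (F G : nat -> fps R) (x y z t : fps R).

Definition eqmodX (n : nat) x y : Prop :=
  forall m, (m <= n)%N -> coef x m = coef y m.

Lemma eqmodX_refl n x : eqmodX n x x. Proof. by []. Qed.

Lemma eqmodX_sym n x y : eqmodX n x y -> eqmodX n y x.
Proof. by move=> xy m le_mn; rewrite xy. Qed.

Lemma eqmodX_trans n y x z : eqmodX n x y -> eqmodX n y z -> eqmodX n x z.
Proof. by move=> xy yz m le_mn; rewrite xy ?yz. Qed.

Lemma eqmodXM n x y z t :
  eqmodX n x y -> eqmodX n z t -> eqmodX n (x * z) (y * t).
Proof.
move=> xy zt m le_mn; rewrite !fps_coefM; apply: eq_bigr => -[i /= lt_im] _.
by rewrite xy ?zt // (leq_trans _ le_mn) // leq_subr.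
Qed.

Lemma eqmodXP x y : (forall n, eqmodX n x y) -> x = y.
Proof. by move=> xy; apply/fpsP => n; apply: (xy n). Qed.

(** The i-th factor is 1 up to degree i: the first n + 1 factors determine the
    product up to degree n. *)
Definition tends1 F : Prop :=
  forall i j, (j <= i)%N -> coef (F i) j = (j == 0)%:R.

Lemma eqmodX_infprod F n M : tends1 F -> (n <= M)%N ->
  eqmodX n (fps_infprod F) (\prod_(i < M) F i).
Proof.
move=> F1 le_nM m le_mn; apply: coef_fps_infprod => i j le_Mi le_jm.
by apply: F1; rewrite (leq_trans le_jm) // (leq_trans le_mn) // (leq_trans le_nM).
Qed.

Lemma tends1M F G : tends1 F -> tends1 G -> tends1 (fun i => F i * G i).
Proof.
move=> F1 G1 i j le_ji.
have F1i : eqmodX i (F i) 1 by move=> m le_mi; apply: F1.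
have G1i : eqmodX i (G i) 1 by move=> m le_mi; apply: G1.
by rewrite (eqmodXM F1i G1i) // mulr1.
Qed.

Lemma tends1_1 : tends1 (fun=> 1). Proof. by []. Qed.

Lemma tends1_prod m (F : nat -> nat -> fps R) :
  (forall c, tends1 (F c)) -> tends1 (fun i => \prod_(c < m) F c i).
Proof.
move=> F1; elim: m => [|m IHm].
  by move=> i j le_ji; rewrite big_ord0.
by move=> i j le_ji; rewrite big_ord_recr /=; exact: (tends1M IHm (F1 m)).
Qed.

Lemma tends1_sub (h : nat -> nat) F : (forall i, (i <= h i)%N) ->
  tends1 F -> tends1 (F \o h).
Proof. by move=> le_h F1 i j le_ji; apply: F1; apply: leq_trans (le_h i). Qed.

Lemma eq_infprod F G : F =1 G -> fps_infprod F = fps_infprod G.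
Proof. by move=> /funext ->. Qed.

Lemma infprodM F G : tends1 F -> tends1 G ->
  fps_infprod (fun i => F i * G i) = fps_infprod F * fps_infprod G.
Proof.
move=> F1 G1; apply: eqmodXP => n.
apply: eqmodX_trans (eqmodX_infprod (tends1M F1 G1) (leqnn n)) _.
rewrite big_split; apply: eqmodX_sym.
by apply: eqmodXM; apply: eqmodX_infprod.
Qed.

Lemma infprod1 : fps_infprod (fun=> 1 : fps R) = 1.
Proof.
apply: eqmodXP => n; apply: eqmodX_trans (eqmodX_infprod tends1_1 (leqnn n)) _.
by rewrite big1.
Qed.

Lemma infprod_prod m (F : nat -> nat -> fps R) : (forall c, tends1 (F c)) ->
  fps_infprod (fun i => \prod_(c < m) F c i) = \prod_(c < m) fps_infprod (F c).
Proof.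
move=> F1; elim: m => [|m IHm].
  rewrite big_ord0 -[RHS]infprod1; apply: eq_infprod => i; exact: big_ord0.
rewrite big_ord_recr /= -IHm -infprodM //; last exact: tends1_prod.
by apply: eq_infprod => i; rewrite big_ord_recr.
Qed.

Lemma infprod_recl F : tends1 F -> fps_infprod F = F 0%N * fps_infprod (F \o S).
Proof.
move=> F1; have FS1 : tends1 (F \o S) by apply: tends1_sub F1.
apply: eqmodXP => n; apply: eqmodX_trans (eqmodX_infprod F1 (leqnSn n)) _.
rewrite big_ord_recl; apply: eqmodXM => //; apply: eqmodX_sym.
exact: eqmodX_infprod.
Qed.

Lemma infprod_regroup m F : (0 < m)%N -> tends1 F ->
  fps_infprod F = fps_infprod (fun i => \prod_(c < m) F (m * i + c)%N).
Proof.
move=> m_gt0 F1.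
have le_m i : (i <= m * i)%N by rewrite leq_pmull.
have G1 : tends1 (fun i => \prod_(c < m) F (m * i + c)%N).
  apply: (@tends1_prod m (fun c i => F (m * i + c)%N)) => c.
  apply: (@tends1_sub (fun i => m * i + c)%N) F1 => i.
  by rewrite (leq_trans (le_m i)) ?leq_addr.
have prodE n : \prod_(i < m * n) F i = \prod_(i < n) \prod_(c < m) F (m * i + c)%N.
  elim: n => [|n IHn]; first by rewrite muln0 !big_ord0.
  by rewrite mulnS addnC big_split_ord /= IHn [RHS]big_ord_recr.
apply: eqmodXP => n; apply: eqmodX_trans (eqmodX_infprod F1 (le_m n)) _.
by rewrite prodE; apply: eqmodX_sym; apply: eqmodX_infprod.
Qed.

End InfProd.

(** * The Jacobi triple product *)

Section TripleProduct.
Variables (p : fps int) (p0 : coef p 0 = 0).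
(** A sequence (-1)^k w_k p^(T_k) over the integers, with w_(k+1) + w_(k-1) = c w_k,
    is folded by k -> -1 - k into the sequence (-1)^k u_k; s n is c p^(n+1). The
    case w_k = x^k, where c = x + 1/x, is the usual triple product; w_k = 2 k + 1,
    where c = 2, is its derivative at x = 1. The recurrences are stated without
    negative powers of p. *)
Variables (u s : nat -> fps int).
Hypothesis (u_rec0 : forall n, u 1%N * p ^+ n - u 0%N * p ^+ n.+1 = s n * u 0%N).
Hypothesis (u_rec : forall n k, (k < n)%N ->
  u k.+2 * p ^+ (n - k.+1) + u k * p ^+ (n + k).+2 = s n * u k.+1).

Local Notation ip := (invfac p).
Local Notation ipred := (invfac_pred p).
Local Notation dd := (bailey_kernel p).

Let ipE n : ip n = (1 - p * p ^+ n) * ip n.+1.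
Proof. by rewrite invfacE // exprS. Qed.

Let ipredE n : ipred n = (1 - p ^+ n) * ip n. Proof. exact: invfac_predE. Qed.

(** Two applications of the q-Pascal rule to a q-binomial coefficient, divided by
    a q-factorial. For k = 0 the neighbour k - 1 is folded back to k = 0. *)
Lemma bailey_kernelS n k : (k <= n.+1)%N ->
  (1 - p ^+ (2 * n).+2) * (1 - p ^+ (2 * n).+3) * dd n.+1 k =
  (1 + p ^+ (2 * n).+2) * dd n k + p ^+ (n.+1 - k) * dd n k.-1 * (k != 0)%:R +
  p ^+ (n + k).+2 * dd n k.+1 + p ^+ n.+1 * dd n 0 * (k == 0)%:R.
Proof.
move=> /subnK; rewrite /bailey_kernel; case: k => [|k].
  move=> _; rewrite !subn0 !addn0 subSS subn0 !mulr0 addr0 mulr1 /=.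
  have -> : (n + 1).+1 = n.+2 by rewrite addn1.
  rewrite ipredE (ipE n) (ipE n.+1) mul2n -addnn !(exprS, exprD).
  by ring.
rewrite /= !mulr0 addr0 mulr1 !subSS.
move: (n - k)%N => a an.
have -> : n = (a + k)%N by lia.
have -> : (a + k - k.+1 = a.-1)%N by lia.
have -> : ((a + k).+1 - k = a.+1)%N by lia.
have -> : (a + k + k.+2 = (a + k + k).+2)%N by lia.
have -> : ((a + k).+1 + k.+1 = (a + k + k).+2)%N by lia.
have -> : (a + k + k.+1 = (a + k + k).+1)%N by lia.
rewrite /= !ipredE (ipE (a + k + k).+1) (ipE (a + k + k).+2).
rewrite mul2n -addnn; case: a {an} => [|a] /=.
  by rewrite !add0n !(exprS, exprD); ring.
by rewrite (ipE a) !addSn !addnS !(exprS, exprD); ring.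
Qed.

Let tsum n m := \sum_(k < m) (-1) ^+ k * u k * dd n k.

(** The neighbours k - 1 and k + 1 of the Pascal rule recombine into s n u_k by the
    recurrence of u, up to the two boundary terms at m. *)
Lemma triple_partial n m : (m <= n)%N ->
  (1 - p ^+ (2 * n).+2) * (1 - p ^+ (2 * n).+3) * tsum n.+1 m.+1 =
  (1 + p ^+ (2 * n).+2 - s n) * tsum n m.+1 +
  (-1) ^+ m * (u m * p ^+ (n + m).+2 * dd n m.+1 + u m.+1 * p ^+ (n - m) * dd n m).
Proof.
rewrite /tsum; elim: m => [|m IHm] le_mn.
  rewrite !big_ord1 mulrCA bailey_kernelS // addn0 subn0 !mulr0 !mulr1 addr0 !mul1r.
  apply/eqP; rewrite -subr_eq0; apply/eqP.
  transitivity ((s n * u 0%N - (u 1%N * p ^+ n - u 0%N * p ^+ n.+1)) * dd n 0).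
    by ring.
  by rewrite u_rec0 subrr mul0r.
rewrite big_ord_recr mulrDr IHm ?(ltnW le_mn) // [in RHS]big_ord_recr /=.
have := @bailey_kernelS n m.+1 (leqW le_mn).
move: (_ * (1 - p ^+ (2 * n).+3)) => K KE.
rewrite [K * (_ * _)]mulrCA {}KE /= !mulr0 addr0 mulr1 subSS (exprS (-1)) addnS.
apply/eqP; rewrite -subr_eq0; apply/eqP.
transitivity ((-1) ^+ m * dd n m.+1 *
    (u m.+2 * p ^+ (n - m.+1) + u m * p ^+ (n + m).+2 - s n * u m.+1)).
  move: (\sum_(k < m.+1) _) (p ^+ _) (p ^+ _) (p ^+ _) (p ^+ _) (p ^+ _) => *.
  by ring.
by rewrite u_rec // subrr mulr0.
Qed.

Lemma triple_step n :
  (1 - p ^+ (2 * n).+2) * (1 - p ^+ (2 * n).+3) * tsum n.+1 n.+2 =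
  (1 + p ^+ (2 * n).+2 - s n) * tsum n n.+1.
Proof.
rewrite {1}/tsum big_ord_recr mulrDr -/(tsum n.+1 n.+1) triple_partial //=.
have := @bailey_kernelS n n.+1 (leqnn _).
move: (_ * (1 - p ^+ (2 * n).+3)) => K KE.
rewrite [K * (_ * _)]mulrCA {}KE /= !subnn.
rewrite (@bailey_kernel_gt _ n n.+1) // (@bailey_kernel_gt _ n n.+2) ?leqnSn //.
by rewrite !(mulr0, expr0, exprS) /=; ring.
Qed.

Lemma finite_triple_product n :
  qpoch p p (2 * n).+1 * tsum n n.+1 =
  u 0%N * \prod_(i < n) (1 + p ^+ (2 * i).+2 - s i).
Proof.
elim: n => [|n IHn].
  rewrite /tsum big_ord1 big_ord0 /bailey_kernel /= /invfac mul1r mulrCA; congr (_ * _).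
  rewrite mulrC -mulrA mulVr ?qpoch_unit //.
  by rewrite /qpoch big_ord0 invr1 mulr1.
rewrite big_ord_recr /= mulrA -IHn (_ : (2 * n.+1).+1 = (2 * n).+3); last by lia.
have -> : qpoch p p (2 * n).+3 =
    qpoch p p (2 * n).+1 * ((1 - p ^+ (2 * n).+2) * (1 - p ^+ (2 * n).+3)).
  by rewrite {1}/qpoch 2!big_ord_recr /= -!exprS mulrA.
by rewrite -mulrA triple_step; ring.
Qed.

Hypothesis u_ord : forall k m, (m < k)%N -> coef (u k) m = 0.
Hypothesis s_ord : forall i m, (m <= i)%N -> coef (s i) m = 0.

Let coef_pX n m : (m < n)%N -> coef (p ^+ n) m = 0.
Proof.
elim: n m => // n IHn m lt_mn; rewrite exprS fps_coefM big1 // => -[[|i] lt_i] _ /=.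
  by rewrite p0 mul0r.
by rewrite IHn ?mulr0 //; lia.
Qed.

Lemma tends1_qfac : tends1 (fun i => 1 - p ^+ i.+1).
Proof. by move=> i j le_ji; rewrite fps_coefB coef_pX // subr0. Qed.

Lemma tends1_triple : tends1 (fun i => 1 + p ^+ (2 * i).+2 - s i).
Proof.
move=> i j le_ji; rewrite fps_coefB fps_coefD s_ord // coef_pX ?subr0 ?addr0 //; lia.
Qed.

(** In the limit both q-factorials of the kernel become the infinite product. *)
Theorem triple_product :
  fps_sum (fun k : nat => (-1) ^+ k * u k) =
  u 0%N * fps_infprod (fun i => 1 + p ^+ (2 * i).+2 - s i) *
  fps_infprod (fun i => 1 - p ^+ i.+1).
Proof.
pose P := fps_infprod (fun i => 1 - p ^+ i.+1).
have PE N M : (N <= M)%N -> eqmodX N P (qpoch p p M).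
  move=> le_NM; have := eqmodX_infprod tends1_qfac le_NM.
  by rewrite /qpoch; under [in X in _ -> X]eq_bigr do rewrite -exprS.
have coef_sign k F m : (forall j, (j <= m)%N -> coef F j = 0) ->
    coef ((-1) ^+ k * F) m = 0.
  move=> F0; rewrite fps_coefM big1 // => j _.
  by rewrite F0 ?mulr0 // leq_subr.
apply: eqmodXP => N.
(* For k <= N both n - k and n + k + 1 are then at least N. *)
pose n := (2 * N)%N.
apply: (@eqmodX_trans _ _ (P * (u 0%N * \prod_(i < n) (1 + p ^+ (2 * i).+2 - s i)))).
  rewrite -finite_triple_product /tsum !mulr_sumr => m le_mN.
  rewrite (@coef_fps_sum_seq _ _ (iota 0 n.+1)) ?iota_uniq //; last first.
    move=> k; rewrite mem_iota add0n ltnS; apply: contraNT; rewrite -ltnNge => lt_nk.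
    by apply/eqP/coef_sign => j le_jm; apply: u_ord; lia.
  rewrite fps_coef_sum -(big_mkord xpredT (fun k => coef (P * (qpoch p p (2 * n).+1 *
    ((-1) ^+ k * u k * dd n k))) m)) /index_iota subn0.
  apply: eq_big_seq => k; rewrite mem_iota add0n ltnS => /andP[_ le_kn].
  have [lt_Nk|le_kN] := ltnP N k.
    rewrite coef_sign => [|j le_jm]; last by apply: u_ord; lia.
    have -> : P * (qpoch p p (2 * n).+1 * ((-1) ^+ k * u k * dd n k)) =
      (-1) ^+ k * (P * qpoch p p (2 * n).+1 * dd n k * u k) by ring.
    rewrite coef_sign // => j le_jm; rewrite fps_coefM big1 // => i _.
    by rewrite u_ord ?mulr0 //; lia.
  have e1 : eqmodX N (P * qpoch p p (2 * n).+1 * dd n k) 1.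
    have <- : qpoch p p (n - k) * qpoch p p (n + k).+1 * dd n k = 1.
      rewrite /bailey_kernel subSn //= mulrACA /invfac !divrr ?mulr1 ?qpoch_unit //.
    apply: eqmodXM => //; apply: eqmodXM; first by apply: PE; rewrite /n; lia.
    by apply: eqmodX_trans (eqmodX_sym (PE N _ _)) (PE N _ _); rewrite /n; lia.
  have -> : P * (qpoch p p (2 * n).+1 * ((-1) ^+ k * u k * dd n k)) =
    (P * qpoch p p (2 * n).+1 * dd n k) * ((-1) ^+ k * u k) by ring.
  by rewrite (eqmodXM e1 (eqmodX_refl (n := N) _)) // mul1r.
rewrite mulrC; apply: eqmodXM => //; apply: eqmodXM => //; apply: eqmodX_sym.
by apply: eqmodX_infprod; [exact: tends1_triple | rewrite /n; lia].
Qed.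

End TripleProduct.

(** * Product formulas for theta series *)

Definition prodq (e : fps int) (a b : nat) : fps int :=
  fps_infprod (fun i => 1 - e * q ^+ (a + b * i)).

Lemma coef_mulqX (F : fps int) n m : (m < n)%N -> coef (F * q ^+ n) m = 0.
Proof. by move=> lt_mn; rewrite mulrC coef_fpsXnM lt_mn. Qed.

Lemma tends1_prodq e a b : (0 < a)%N -> (0 < b)%N ->
  tends1 (fun i => 1 - e * q ^+ (a + b * i)).
Proof. by move=> a0 b0 i j le_ji; rewrite fps_coefB coef_mulqX ?subr0 //; nia. Qed.

Lemma ell_prodq k : ell k = prodq 1 k k.
Proof. by apply: eq_infprod => i; rewrite mul1r mulnS. Qed.

Section TripleSpecial.
Variables (a c : nat) (e : fps int).
Hypotheses (a_gt0 : (0 < a)%N) (c_gt0 : (0 < c)%N) (e2 : e * e = 1).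
Let b := (a + c)%N.

Let A (k : int) := qpow (b%:Z * tri k - a%:Z * k).
Let B (k : int) := qpow (b%:Z * tri k + a%:Z * (k + 1)).
Let u (k : nat) := e ^+ k * (A k - e * B k).
Let s (n : nat) := e * (q ^+ (c + b * n) + q ^+ (a + b * n.+1)).

Let tri_ge_nat (k : nat) : k%:Z <= tri k.
Proof. by have := triE k; nia. Qed.

Let A_ge (k : nat) : k%:Z <= b%:Z * tri k - a%:Z * k%:Z.
Proof. by have := tri_ge_nat k; have := tri_ge0 k; rewrite /b PoszD; nia. Qed.

Let B_ge (k : nat) : k%:Z <= b%:Z * tri k + a%:Z * (k%:Z + 1).
Proof. by have := tri_ge_nat k; have := tri_ge0 k; rewrite /b PoszD; nia. Qed.

Let qpow_shift (x y : int) (m n : nat) : 0 <= x -> 0 <= y ->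
  x + m%:Z = y + n%:Z -> qpow x * q ^+ m = qpow y * q ^+ n.
Proof. by move=> x0 y0 xy; rewrite -!qpow_nat -!qpowD // xy. Qed.

(** The triple product for x = e q^(-a), to the base p = q^b, where e is 1 or -1:
    its factors 1 - (x + 1/x) p^i + p^(2 i) are the products of
    1 - e q^(b i - a) and 1 - e q^(b i + a). *)
Lemma triple_special :
  fps_sum (fun k : nat => (- e) ^+ k * (A k - e * B k)) =
  prodq e a b * prodq e c b * ell b.
Proof.
pose p := q ^+ b.
have b_gt0 : (0 < b)%N by rewrite addn_gt0 a_gt0.
have p0 : coef p 0 = 0 by rewrite coef_fpsXn; case: b b_gt0.
have trin k : tri k.+1%:Z = tri k%:Z + k%:Z + 1 by rewrite -triS; congr tri; lia.
have t0 : tri 0%N = 0 by [].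
have A0 : A 0%N = 1 by rewrite /A t0 !mulr0.
have B0 : B 0%N = q ^+ a by rewrite /B t0 mulr0 !add0r mulr1.
have A_ge0 (k : nat) : 0 <= b%:Z * tri k - a%:Z * k%:Z by apply: le_trans (A_ge k).
have B_ge0 (k : nat) : 0 <= b%:Z * tri k + a%:Z * (k%:Z + 1) by apply: le_trans (B_ge k).
have rec0 n : u 1%N * p ^+ n - u 0%N * p ^+ n.+1 = s n * u 0%N.
  have A1 : A 1%N = q ^+ c by rewrite /A -(qpow_nat c); congr qpow; rewrite trin /b; lia.
  have B1 : B 1%N = q ^+ (c + a + a + a).
    by rewrite /B -(qpow_nat (_ + a)%N); congr qpow; rewrite trin /b; lia.
  rewrite /u /s A1 B1 A0 B0 !(expr0, expr1) /p -!exprM mulnS /b !exprD.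
  move: (q ^+ a) (q ^+ c) (q ^+ ((a + c) * n)) => x y z.
  apply/eqP; rewrite -subr_eq0; apply/eqP.
  by transitivity ((e * e - 1) * (x * y * z)); [ring | rewrite e2 subrr mul0r].
have rec n k : (k < n)%N ->
    u k.+2 * p ^+ (n - k.+1) + u k * p ^+ (n + k).+2 = s n * u k.+1.
  move=> /subnK <-; move: (n - k.+1)%N => d; rewrite addnK.
  have A2 : A k.+2 * p ^+ d = A k.+1 * q ^+ (c + b * (d + k.+1)).
    by rewrite /p -exprM; apply: qpow_shift => //; rewrite (trin k.+1) /b; lia.
  have B2 : B k.+2 * p ^+ d = B k.+1 * q ^+ (a + b * (d + k.+1).+1).
    by rewrite /p -exprM; apply: qpow_shift => //; rewrite (trin k.+1) /b; lia.
  have A1 : A k * p ^+ (d + k.+1 + k).+2 = A k.+1 * q ^+ (a + b * (d + k.+1).+1).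
    by rewrite /p -exprM; apply: qpow_shift => //; rewrite (trin k) /b; lia.
  have B1 : B k * p ^+ (d + k.+1 + k).+2 = B k.+1 * q ^+ (c + b * (d + k.+1)).
    by rewrite /p -exprM; apply: qpow_shift => //; rewrite (trin k) /b; lia.
  rewrite /u /s; transitivity (e ^+ k.+2 * (A k.+2 * p ^+ d - e * (B k.+2 * p ^+ d)) +
     e ^+ k * (A k * p ^+ (d + k.+1 + k).+2 - e * (B k * p ^+ (d + k.+1 + k).+2))).
    by ring.
  rewrite A2 B2 A1 B1 !(exprS e) (mulrA e e) e2 mul1r.
  transitivity ((e * e) * e ^+ k * (A k.+1 - e * B k.+1) *
    (q ^+ (c + b * (d + k.+1)) + q ^+ (a + b * (d + k.+1).+1))); last by ring.
  by rewrite e2; ring.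
have ord k m : (m < k)%N -> coef (u k) m = 0.
  move=> lt_mk; rewrite /u mulrC.
  have [x xE] : exists x : nat, x%:Z = b%:Z * tri k - a%:Z * k%:Z.
    by exists (absz (b%:Z * tri k - a%:Z * k%:Z)%R); have := A_ge0 k; lia.
  have [y yE] : exists y : nat, y%:Z = b%:Z * tri k + a%:Z * (k%:Z + 1).
    by exists (absz (b%:Z * tri k + a%:Z * (k%:Z + 1))%R); have := B_ge0 k; lia.
  have := A_ge k; have := B_ge k; rewrite /A /B -xE -yE => kx ky.
  have -> : (qpow x - e * qpow y) * e ^+ k = e ^+ k * q ^+ x - e * e ^+ k * q ^+ y.
    by rewrite !qpow_nat; ring.
  by rewrite fps_coefB !coef_mulqX ?subr0 //; lia.
have sord i m : (m <= i)%N -> coef (s i) m = 0.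
  by move=> le_mi; rewrite /s mulrDr fps_coefD !coef_mulqX ?addr0 //; nia.
have := triple_product p0 rec0 rec ord sord.
have -> : (fun k : nat => (-1) ^+ k * u k) = (fun k : nat => (- e) ^+ k * (A k - e * B k)).
  by apply/funext => k; rewrite /u mulrA -exprMn mulN1r.
move=> ->; congr (_ * _); last first.
  by rewrite ell_prodq; apply: eq_infprod => i; rewrite mul1r /p -exprM mulnS.
rewrite (_ : fps_infprod _ = fps_infprod (fun i =>
   (1 - e * q ^+ (a + b * i.+1)) * (1 - e * q ^+ (c + b * i)))); last first.
  apply: eq_infprod => i; rewrite /s.
  have -> : p ^+ (2 * i).+2 = e * e * (q ^+ (a + b * i.+1) * q ^+ (c + b * i)).
    by rewrite e2 mul1r -exprD /p -exprM; congr (_ ^+ _); rewrite /b; lia.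
  by ring.
rewrite infprodM; last 2 first.
- exact: (tends1_sub _ (@tends1_prodq e a b a_gt0 b_gt0)).
- exact: tends1_prodq.
rewrite mulrA; congr (_ * _); rewrite /prodq [RHS]infprod_recl; last exact: tends1_prodq.
by rewrite /u A0 B0 expr0 mul1r muln0 addn0.
Qed.

End TripleSpecial.

Lemma coef_prodq0 e a b : (0 < a)%N -> (0 < b)%N -> coef (prodq e a b) 0 = 1.
Proof.
move=> a0 b0; have := eqmodX_infprod (@tends1_prodq e a b a0 b0) (leqnn 0).
by move=> /(_ 0%N isT) ->; rewrite big_ord0.
Qed.

Lemma prodq_split e a b m : (0 < a)%N -> (0 < b)%N -> (0 < m)%N ->
  prodq e a b = \prod_(c <- iota 0 m) prodq e (a + b * c) (b * m).
Proof.
move=> a0 b0 m0; rewrite /prodq (infprod_regroup m0); last exact: tends1_prodq.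
rewrite (_ : iota 0 m = index_iota 0 m) ?big_mkord; last by rewrite /index_iota subn0.
rewrite -(@infprod_prod _ m (fun c i => 1 - e * q ^+ (a + b * c + b * m * i))).
  apply: eq_infprod => i; apply: eq_bigr => c _.
  by congr (1 - e * q ^+ _); lia.
by move=> c; apply: tends1_prodq; rewrite ?addn_gt0 ?a0 // muln_gt0 b0.
Qed.

Lemma prodq_sqr a b : (0 < a)%N -> (0 < b)%N ->
  prodq (-1) a b * prodq 1 a b = prodq 1 (2 * a) (2 * b).
Proof.
move=> a0 b0; rewrite /prodq -infprodM; try exact: tends1_prodq.
apply: eq_infprod => i; rewrite mulN1r !mul1r opprK.
by have -> : (2 * a + 2 * b * i = (a + b * i) * 2)%N; [lia | rewrite exprM; ring].
Qed.

Lemma ell_split m k : (0 < m)%N -> (0 < k)%N ->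
  ell m = \prod_(c <- iota 0 k) prodq 1 (m + m * c) (m * k).
Proof. by move=> m0 k0; rewrite ell_prodq (@prodq_split _ _ _ k). Qed.

Lemma dilM m F G : (0 < m)%N -> dil m (F * G) = dil m F * dil m G.
Proof.
move=> m_gt0; apply/fpsP => n; rewrite coef_dil; case: ifP => [/dvdnP[j ->]|mn].
  rewrite mulnK // -(@sect_dil m G) // -sect_dilM // coef_sect addn0 mulnC.
  by rewrite sect_dil.
rewrite fps_coefM big1 // => i _; rewrite !coef_dil; case: ifP => mi; last by rewrite mul0r.
case: ifP => mj; last by rewrite mulr0.
by rewrite -(subnKC (leq_ord i)) dvdn_add in mn.
Qed.

Lemma dil_prod m (I : Type) (r : seq I) (F : I -> fps int) : (0 < m)%N ->
  dil m (\prod_(i <- r) F i) = \prod_(i <- r) dil m (F i).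
Proof.
move=> m0; elim: r => [|i r IHr]; last by rewrite !big_cons dilM // IHr.
by rewrite !big_nil -[1]/(qpow 0) dil_qpow // mulr0.
Qed.

Lemma dil_ell m k : (0 < m)%N -> (0 < k)%N -> dil m (ell k) = ell (m * k).
Proof.
move=> m0 k0; apply: eqmodXP => n j le_jn.
have t1 d : (0 < d)%N -> tends1 (fun i => 1 - q ^+ (d * i.+1)).
  by move=> d0 i l le_li; rewrite -[q ^+ _]mul1r fps_coefB coef_mulqX ?subr0 //; nia.
have mk0 : (0 < m * k)%N by rewrite muln_gt0 m0.
rewrite [in RHS](eqmodX_infprod (t1 _ mk0) (leqnn n)) //.
under [in RHS]eq_bigr do rewrite -mulnA -dil1B //.
rewrite -dil_prod // !coef_dil; case: ifP => // mj.
by apply: (eqmodX_infprod (t1 _ k0) (leqnn n)); rewrite (leq_trans (leq_div _ _)).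
Qed.

Lemma coef_ell0 m : (0 < m)%N -> coef (ell m) 0 = 1.
Proof. by move=> m0; rewrite ell_coef // big_ord0. Qed.

Lemma phi_prod m : (0 < m)%N ->
  phi m = prodq 1 m (2 * m) * prodq 1 m (2 * m) * ell (2 * m).
Proof.
move=> m0; rewrite mul2n -addnn -triple_special ?mulr1 // /phi.
rewrite fps_sum_int; last exact: summable_phi.
apply: eq_fps_sum => k.
rewrite sgnz_opp1 mulNr -mulrBr mul1r; congr (_ * (qpow _ - qpow _)).
  by have := triE k; rewrite PoszD expr2; nia.
by have := triE k; rewrite PoszD expr2; nia.
Qed.

Lemma phi_ell m : (0 < m)%N -> phi m * ell (2 * m) = ell m ^+ 2.
Proof.
move=> m0; rewrite phi_prod // (@ell_split m 2) // big_cons big_seq1.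
rewrite muln0 addn0 muln1 addnn -mul2n (mulnC m) -ell_prodq.
by ring.
Qed.

(** The exponents T_(2k) = 2 k^2 + k and T_(2k+1) = 2 k^2 + 3 k + 1 are the two halves
    of a bilateral series; h and g number them. *)
Lemma psi_prod m : (0 < m)%N ->
  psi m = prodq (-1) m (4 * m) * prodq (-1) (3 * m) (4 * m) * ell (4 * m).
Proof.
move=> m0; have -> : (4 * m = m + 3 * m)%N by lia.
rewrite -triple_special ?muln_gt0 // ?mulrNN ?mulr1 // /psi opprK.
pose h (z : int) : nat := match z with Posz k => (2 * k)%N | Negz k => (2 * k).+1 end.
pose g (n : nat) : int := if odd n then Negz n./2 else Posz n./2.
have hK : cancel h g.
  move=> [k|k]; rewrite /h /g mul2n /= odd_double /= ?doubleK //.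
  by rewrite uphalf_double.
have gK : cancel g h.
  by move=> n; rewrite /g; case: ifP => on /=; rewrite mul2n -{2}(odd_double_half n) on.
rewrite (fps_sum_bij _ hK gK) fps_sum_int; last first.
  apply: (summable_comp (can_inj hK)); apply: summable_nat => i n lt_ni.
  rewrite coef_qpow; case: (n%:Z =P _) => // nE.
  by have := triE i; nia.
apply: eq_fps_sum => k; rewrite expr1n mul1r mulN1r opprK.
have -> : - 1 - k%:Z = Negz k by rewrite NegzE; lia.
rewrite /=; congr (qpow _ + qpow _).
  by have := triE k; have := triE (2 * k)%N; nia.
by have := triE k; have := triE (2 * k).+1; nia.
Qed.

Lemma psi_ell m : (0 < m)%N -> psi m * ell m = ell (2 * m) ^+ 2.
Proof.
move=> m0; have m2 : (0 < 2 * m)%N by rewrite muln_gt0.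
have e1 : ell m = prodq 1 m (2 * m) * ell (2 * m).
  rewrite (@ell_split m 2) // big_cons big_seq1 muln0 addn0 muln1 addnn -mul2n.
  by rewrite (mulnC m) -ell_prodq.
have e2 : ell (2 * m) = prodq 1 (2 * m) (2 * (2 * m)) * ell (4 * m).
  rewrite (@ell_split (2 * m) 2) // big_cons big_seq1.
  rewrite muln0 addn0 muln1 ell_prodq; congr (prodq _ _ _ * prodq _ _ _); lia.
have e3 : prodq (-1) m (4 * m) * prodq (-1) (3 * m) (4 * m) = prodq (-1) m (2 * m).
  rewrite [RHS](@prodq_split _ m (2 * m) 2) // big_cons big_seq1 muln0 addn0.
  by congr (prodq _ _ _ * prodq _ _ _); lia.
rewrite psi_prod // e3 e1.
transitivity (ell (2 * m) * (prodq (-1) m (2 * m) * prodq 1 m (2 * m) * ell (4 * m))).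
  by ring.
by rewrite prodq_sqr // -e2 expr2.
Qed.

(** Euler's pentagonal number theorem. *)
Lemma penta_ell : penta = ell 1.
Proof.
have -> : ell 1 = prodq 1 2 3 * prodq 1 1 3 * ell 3.
  rewrite (@ell_split 1 3) // 2!big_cons big_seq1 !mul1n !add1n -(ell_prodq 3).
  by rewrite mulrCA mulrA.
rewrite -[RHS](@triple_special 2 1) ?mulr1 // /penta.
rewrite fps_sum_int; last exact: summable_penta.
apply: eq_fps_sum => k; rewrite sgnz_opp1 tri_opp mulNr -mulrBr mul1r.
by congr (_ * (qpow _ - qpow _)); lia.
Qed.

(** Jacobi's formula for the cube of the Euler product: the degenerate case
    w_k = 2 k + 1 of the triple product, where the factors become (1 - p^i)^2. *)
Lemma jac_ell m : (0 < m)%N -> jac m = ell m ^+ 3.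
Proof.
move=> m0; pose p := q ^+ m.
pose u (k : nat) := (2 * k%:Z + 1)%:~R * qpow (m%:Z * tri k).
pose s (n : nat) := 2 * p ^+ n.+1.
have p0 : coef p 0 = 0 by rewrite coef_fpsXn; case: m m0 @p @u @s.
have pE n : p ^+ n = qpow (m * n)%N by rewrite /p -exprM.
have trin (k : nat) : tri k.+1%:Z = tri k%:Z + k%:Z + 1 by rewrite -triS; congr tri; lia.
have ge0 (k : nat) : k%:Z <= m%:Z * tri k by have := triE k; nia.
have e0 (k : nat) : 0 <= m%:Z * tri k by apply: le_trans (ge0 k).
have u0 : u 0%N = 1 by rewrite /u (_ : tri 0%N = 0) // (mulr0 m%:Z) qpow0 mulr1.
have u1 : u 1%N = 3 * p by rewrite /u (_ : tri 1%N = 1) // (mulr1 m%:Z) qpow_nat.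
have rec0 n : u 1%N * p ^+ n - u 0%N * p ^+ n.+1 = s n * u 0%N.
  by rewrite u0 u1 /s !exprS; ring.
have rec n k : (k < n)%N ->
    u k.+2 * p ^+ (n - k.+1) + u k * p ^+ (n + k).+2 = s n * u k.+1.
  move=> /subnK <-; move: (n - k.+1)%N => d; rewrite addnK.
  have A2 : qpow (m%:Z * tri k.+2) * p ^+ d =
      qpow (m%:Z * tri k.+1) * p ^+ (d + k.+1).+1.
    by rewrite !pE -!qpowD //; congr qpow; rewrite (trin k.+1); lia.
  have A0 : qpow (m%:Z * tri k) * p ^+ (d + k.+1 + k).+2 =
      qpow (m%:Z * tri k.+1) * p ^+ (d + k.+1).+1.
    by rewrite !pE -!qpowD //; congr qpow; rewrite (trin k); lia.
  rewrite /u /s -!mulrA A2 A0.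
  have -> : 2 * k.+2%:Z + 1 = 2 * k%:Z + 1 + 4 by lia.
  have -> : 2 * k.+1%:Z + 1 = 2 * k%:Z + 1 + 2 by lia.
  by rewrite 2!(rmorphD _ _ (_%:Z)) /=; ring.
have ord k j : (j < k)%N -> coef (u k) j = 0.
  move=> lt_jk; rewrite /u; have := ge0 k.
  have [x <-] : exists x : nat, x%:Z = m%:Z * tri k.
    by exists (absz (m%:Z * tri k)%R); have := ge0 k; lia.
  by move=> kx; rewrite qpow_nat coef_mulqX //; lia.
have sord i j : (j <= i)%N -> coef (s i) j = 0.
  by move=> le_ji; rewrite /s /p -exprM coef_mulqX //; nia.
have := triple_product p0 rec0 rec ord sord.
have -> : fps_sum (fun k : nat => (-1) ^+ k * u k) = jac m.
  by apply: eq_fps_sum => k; rewrite /u mulrA sgnz_nat.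
move=> ->; rewrite u0 mul1r.
have PE : fps_infprod (fun i => 1 - p ^+ i.+1) = ell m.
  by apply: eq_infprod => i; rewrite /p -exprM.
rewrite (@eq_infprod _ _ (fun i => (1 - p ^+ i.+1) * (1 - p ^+ i.+1))); last first.
  move=> i; rewrite /s (_ : (2 * i).+2 = (i.+1 + i.+1)%N); last by lia.
  by rewrite exprD; ring.
by rewrite infprodM ?PE; [ring | exact: tends1_qfac | exact: tends1_qfac].
Qed.

(** The two cubic companions of psi and phi: psi(q) and phi(q) are combinations
    of them and of psi and phi themselves, at q^3 and q^9. *)
Definition cubic_psi : fps int := fps_sum (fun z : int => qpow (3 * tri z - 2 * z)).

Definition cubic_phi : fps int :=
  fps_sum (fun z : int => sgnz z * qpow (6 * tri z - 5 * z)).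

Lemma summable_cubic_psi : summable (fun z : int => qpow (3 * tri z - 2 * z)).
Proof.
apply: (@eq_summable _ (fun z => sgnz z * (sgnz z * qpow (3 * tri z - 2 * z)))).
  by move=> z; rewrite mulrA sgnz_sqr mul1r.
by apply: summableM; exact: summable_penta.
Qed.

Lemma summable_cubic_phi : summable (fun z : int => sgnz z * qpow (6 * tri z - 5 * z)).
Proof.
apply: (@summable_qpow 2) => z; have := triE z.
by case: (lerP 0 z) => z0; nia.
Qed.

Lemma cubic_psi_ell : cubic_psi * ell 1 * ell 6 = ell 2 * ell 3 ^+ 2.
Proof.
have -> : cubic_psi = prodq (-1) 2 3 * prodq (-1) 1 3 * ell 3.
  rewrite -[RHS](@triple_special 2 1) ?mulrNN ?mulr1 // /cubic_psi.
  rewrite fps_sum_int; last exact: summable_cubic_psi.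
  apply: eq_fps_sum => k; rewrite tri_opp opprK expr1n mul1r mulN1r opprK.
  by congr (qpow _ + qpow _); lia.
have -> : ell 1 = prodq 1 1 3 * (prodq 1 2 3 * ell 3).
  by rewrite (@ell_split 1 3) // 2!big_cons big_seq1 !mul1n !add1n (ell_prodq 3).
have -> : ell 2 = prodq 1 2 6 * (prodq 1 4 6 * ell 6).
  by rewrite (@ell_split 2 3) // 2!big_cons big_seq1 (ell_prodq 6).
have <- : prodq (-1) 1 3 * prodq 1 1 3 = prodq 1 2 6 by exact: prodq_sqr.
have <- : prodq (-1) 2 3 * prodq 1 2 3 = prodq 1 4 6 by exact: prodq_sqr.
move: (prodq (-1) 1 3) (prodq (-1) 2 3) (prodq 1 1 3) (prodq 1 2 3) => x1 x2 x3 x4.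
by move: (ell 3) (ell 6) => y1 y2; ring.
Qed.

Lemma cubic_phi_ell : cubic_phi * ell 2 * ell 3 = ell 1 * ell 6 ^+ 2.
Proof.
have -> : cubic_phi = prodq 1 5 6 * prodq 1 1 6 * ell 6.
  rewrite -[RHS](@triple_special 5 1) ?mulr1 // /cubic_phi.
  rewrite fps_sum_int; last exact: summable_cubic_phi.
  apply: eq_fps_sum => k; rewrite sgnz_opp1 tri_opp mulNr -mulrBr mul1r.
  by congr (_ * (qpow _ - qpow _)); lia.
have -> : ell 2 = prodq 1 2 6 * (prodq 1 4 6 * ell 6).
  by rewrite (@ell_split 2 3) // 2!big_cons big_seq1 (ell_prodq 6).
have -> : ell 3 = prodq 1 3 6 * ell 6.
  by rewrite (@ell_split 3 2) // big_cons big_seq1 (ell_prodq 6).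
have -> : ell 1 = prodq 1 1 6 * (prodq 1 2 6 * (prodq 1 3 6 * (prodq 1 4 6 *
    (prodq 1 5 6 * ell 6)))).
  by rewrite (@ell_split 1 6) // 5!big_cons big_seq1 !mul1n !add1n (ell_prodq 6).
move: (prodq 1 1 6) (prodq 1 2 6) (prodq 1 3 6) => x1 x2 x3.
by move: (prodq 1 4 6) (prodq 1 5 6) (ell 6) => x4 x5 y; ring.
Qed.

(** Both sides are l_3 l_6. *)
Lemma cubic_psi_phi : cubic_psi * cubic_phi = psi 3 * phi 3.
Proof.
have u m : (0 < m)%N -> ell m \is a GRing.unit := @ell_unit m.
have uM (x y : fps int) : x \is a GRing.unit -> y \is a GRing.unit -> x * y \is a GRing.unit.
  by move=> ux uy; rewrite unitrM ux uy.
apply: (mulrI (uM _ _ (uM _ _ (u 1%N isT) (u 6%N isT)) (uM _ _ (u 2%N isT) (u 3%N isT)))).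
have : psi 3 * ell 3 = ell 6 ^+ 2 by exact: psi_ell.
have : phi 3 * ell 6 = ell 3 ^+ 2 by exact: phi_ell.
have := cubic_psi_ell; have := cubic_phi_ell.
move: (ell 1) (ell 2) (ell 3) (ell 6) cubic_psi cubic_phi (psi 3) (phi 3).
move=> x1 x2 x3 x6 a b c d bE aE dE cE.
transitivity (a * x1 * x6 * (b * x2 * x3)); first by ring.
rewrite aE bE; transitivity (x1 * x2 * (c * x3) * (d * x6)); last by ring.
by rewrite cE dE; ring.
Qed.

(** * Cubic dissections of psi and phi *)

Lemma fps_sum_int3 (F : int -> fps int) : summable F ->
  fps_sum F = fps_sum (fun k : int => F (3 * k)) +
              fps_sum (fun k : int => F (3 * k + 1)) +
              fps_sum (fun k : int => F (3 * k - 1)).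
Proof.
move=> sF; pose G c z := if ((z - c) %% 3)%Z == 0 then F z else 0.
have sG c : summable (G c).
  move=> n; have [r rP] := sF n; exists r => z m le_mn; rewrite /G.
  by case: ifP => _; [exact: rP | rewrite fps_coef0 eqxx].
have FE : F =1 fun z => G 0 z + G 1 z + G (- 1) z.
  move=> z; rewrite /G; case: ifP => h0; case: ifP => h1; case: ifP => h2;
    rewrite ?addr0 ?add0r //; lia.
rewrite (eq_fps_sum FE) !fps_sumD //; last by apply: summableD.
have GE c (h : int -> int) : injective h -> (forall k, h k = 3 * k + c) ->
    fps_sum (G c) = fps_sum (fun k => F (h k)).
  move=> h_inj hE; rewrite [LHS](fps_sum_inj h_inj).
    apply: eq_fps_sum => k; rewrite /comp /G hE addrK.
    by have -> : ((3 * k) %% 3)%Z = 0 by lia.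
  move=> z hz; rewrite /G; case: ifP => // /eqP z0.
  case: (hz ((z - c) %/ 3)%Z); rewrite hE; have := divz_eq (z - c) 3; rewrite z0.
  by move: (divz _ _) => d; lia.
congr (_ + _ + _); apply: GE => [x y|k]; lia.
Qed.

(** The triangular numbers T_(3k+1) = 9 T_k + 1 are separated from T_(3k) and
    T_(3k-1), which are multiples of 3. *)
Lemma psi_dissect : psi 1 = dil 3 cubic_psi + q * psi 9.
Proof.
apply: (@fps_mulz_inj 2) => //.
have qE c : 0 <= c -> q * qpow c = qpow (c + 1).
  by move=> c0; rewrite qpowD // mulrC.
have s1 : summable (fun z : int => qpow (1%N%:Z * tri z)).
  by apply: eq_summable (@summable_tri 1 (fun=> 1) isT) => z; rewrite mul1r.
have s9 : summable (fun z : int => qpow (9%N%:Z * tri z)).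
  by apply: eq_summable (@summable_tri 9 (fun=> 1) isT) => z; rewrite mul1r.
rewrite psi_bilateral // mulrDr [_ * (q * _)]mulrCA psi_bilateral // fps_mulr_sumr //.
rewrite fps_sum_int3 // dil_sum.
have -> : fps_sum (fun k : int => qpow (1%N%:Z * tri (3 * k + 1))) =
          fps_sum (fun k => q * qpow (9%N%:Z * tri k)).
  apply: eq_fps_sum => k; rewrite qE; last by have := tri_ge0 k; lia.
  by congr qpow; have := triE (3 * k + 1); have := triE k; nia.
rewrite addrAC; congr (_ + _); rewrite mulr_natl mulr2n; congr (_ + _).
  rewrite [LHS](fps_sum_bij _ (@opprK int) (@opprK int)).
  apply: eq_fps_sum => k; rewrite /comp dil_qpow //; congr qpow.
  rewrite mulrN triN; have := triE (3 * k); have := triE k.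
  by move: (tri (3 * k)) (tri k) => x y; lia.
apply: eq_fps_sum => k; rewrite dil_qpow //; congr qpow.
by have := triE (3 * k - 1); have := triE k; nia.
Qed.

Lemma phi_dissect : phi 1 = phi 9 - 2 * q * dil 3 cubic_phi.
Proof.
have qE c : 0 <= c -> q * qpow c = qpow (c + 1).
  by move=> c0; rewrite qpowD // mulrC.
have dE : dil 3 cubic_phi = fps_sum (fun z => sgnz z * qpow (3%N%:Z * (6 * tri z - 5 * z))).
  rewrite dil_sum; apply: eq_fps_sum => z.
  by rewrite sgnz_int dil_intM dil_qpow.
have sd : summable (fun z : int => sgnz z * qpow (3%N%:Z * (6 * tri z - 5 * z))).
  apply: (@summable_qpow 2) => z; have := triE z.
  by case: (lerP 0 z) => z0; nia.
have qD : q * dil 3 cubic_phi = fps_sum (fun z => sgnz z * qpow ((3 * z - 1) ^+ 2)).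
  rewrite dE fps_mulr_sumr //; apply: eq_fps_sum => z; rewrite mulrCA qE; last first.
    by have := triE z; nia.
  by congr (_ * qpow _); have := triE z; rewrite expr2; nia.
rewrite {1}/phi fps_sum_int3; last exact: summable_phi.
have sg3 k c : sgnz (3 * k + c) = sgnz k * sgnz c.
  by rewrite -sgnzD -[RHS]mul1r -(sgnz_dbl k) -sgnzD; congr sgnz; ring.
have -> : fps_sum (fun k : int => sgnz (3 * k) * qpow (1%N%:Z * (3 * k) ^+ 2)) = phi 9.
  apply: eq_fps_sum => k; rewrite -[3 * k]addr0 sg3 mulr1 addr0.
  by congr (_ * qpow _); ring.
have sN : summable (fun z => sgnz z * qpow ((3 * z - 1) ^+ 2)).
  by apply: (@summable_qpow 2) => z; rewrite expr2; nia.
have m1 : fps_sum (fun k : int => sgnz (3 * k - 1) * qpow (1%N%:Z * (3 * k - 1) ^+ 2)) =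
    - (q * dil 3 cubic_phi).
  rewrite qD -fps_sumN //; apply: eq_fps_sum => k.
  by rewrite sg3 [sgnz (- 1)]expr1 mulrN1 mulNr mul1r.
have p1 : fps_sum (fun k : int => sgnz (3 * k + 1) * qpow (1%N%:Z * (3 * k + 1) ^+ 2)) =
    - (q * dil 3 cubic_phi).
  rewrite -m1 [RHS](fps_sum_bij _ (@opprK int) (@opprK int)); apply: eq_fps_sum => k /=.
  rewrite -[sgnz (3 * k + 1)]sgnzN; congr (sgnz _ * qpow _); ring.
by rewrite m1 p1; ring.
Qed.

(** * The norm of phi over the cube roots of unity *)

Lemma coef_natr (R : comNzRingType) (n m : nat) :
  coef (n%:R : fps R) m = (n * (m == 0))%:R.
Proof.
elim: n => [|n IHn]; first by rewrite mul0n.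
by rewrite -natr1 fps_coefD IHn fps_coef1 -natrD mulSn addnC.
Qed.

Section Twist.
Variable R : comNzRingType.
Implicit Types (x y : fps R) (w : R).

Definition twist w x : fps R := Fps (fun n => w ^+ n * coef x n).

Lemma coef_twist w x n : coef (twist w x) n = w ^+ n * coef x n.
Proof. by []. Qed.

Lemma twistM w x y : twist w (x * y) = twist w x * twist w y.
Proof.
apply/fpsP => n; rewrite coef_twist !fps_coefM mulr_sumr; apply: eq_bigr => i _.
by rewrite !coef_twist mulrACA -exprD subnKC // -ltnS.
Qed.

Lemma twist_prod w (I : Type) (r : seq I) (F : I -> fps R) :
  twist w (\prod_(i <- r) F i) = \prod_(i <- r) twist w (F i).
Proof.
elim: r => [|i r IHr]; last by rewrite !big_cons twistM IHr.
rewrite !big_nil; apply/fpsP => n; rewrite coef_twist fps_coef1.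
by case: n => [|n]; rewrite ?mulr0 // expr0 mul1r.
Qed.

Definition fpsC (c : R) : fps R := Fps (fun n => c * (n == 0)%:R).

Lemma coef_fpsC c n : coef (fpsC c) n = c * (n == 0)%:R.
Proof. by []. Qed.

Lemma coef_fpsCM c x n : coef (fpsC c * x) n = c * coef x n.
Proof.
rewrite fps_coefM big_ord_recl coef_fpsC mulr1 subn0 big1 ?addr0 // => i _.
by rewrite coef_fpsC mulr0 mul0r.
Qed.

Lemma fpsCM c d : fpsC (c * d) = fpsC c * fpsC d.
Proof. by apply/fpsP => n; rewrite coef_fpsCM !coef_fpsC mulrA. Qed.

Lemma fpsCD c d : fpsC (c + d) = fpsC c + fpsC d.
Proof. by apply/fpsP => n; rewrite fps_coefD !coef_fpsC mulrDl. Qed.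

Lemma fpsC1 : fpsC 1 = 1.
Proof. by apply/fpsP => n; rewrite fps_coef1 coef_fpsC mul1r. Qed.

Lemma fpsC0 : fpsC 0 = 0.
Proof. by apply/fpsP => n; rewrite fps_coef0 coef_fpsC mul0r. Qed.

Lemma twist1B w n : twist w (1 - fpsX ^+ n) = 1 - fpsC (w ^+ n) * fpsX ^+ n.
Proof.
apply/fpsP => m; rewrite coef_twist !fps_coefB coef_fpsCM !fps_coef1 coef_fpsXn.
rewrite mulrBr; congr (_ - _); last by case: (m =P n) => [->|_]; rewrite ?mulr0.
by case: m => [|m]; rewrite ?mulr0 // expr0 mul1r.
Qed.

Lemma twistB w x y : twist w (x - y) = twist w x - twist w y.
Proof. by apply/fpsP => n; rewrite fps_coefB !coef_twist fps_coefB mulrBr. Qed.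

Lemma twist_nat w n : twist w n%:R = n%:R.
Proof.
apply/fpsP => m; rewrite coef_twist coef_natr.
by case: m => [|m]; rewrite ?muln0 ?mulr0 // expr0 mul1r.
Qed.

Lemma twistX w : twist w fpsX = fpsC w * fpsX.
Proof.
apply/fpsP => n; rewrite coef_twist coef_fpsCM -[fpsX]expr1 coef_fpsXn.
by case: (n =P 1%N) => [->|_]; rewrite ?mulr0.
Qed.

Lemma tends1_twist w F : tends1 F -> tends1 (fun i => twist w (F i)).
Proof.
move=> F1 i j le_ji; rewrite coef_twist F1 //.
by case: j le_ji => [|j] _; rewrite ?mulr0 // expr0 mul1r.
Qed.

Lemma twist_infprod w F : tends1 F ->
  twist w (fps_infprod F) = fps_infprod (fun i => twist w (F i)).
Proof.
move=> F1; apply: eqmodXP => n m le_mn.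
rewrite (eqmodX_infprod (tends1_twist w F1) (leqnn n)) // -twist_prod !coef_twist.
by rewrite (eqmodX_infprod F1 (leqnn n)).
Qed.

End Twist.

Section IntMap.
Variable R : comNzRingType.

Definition fps_intr (x : fps int) : fps R := Fps (fun n => (coef x n)%:~R).

Lemma coef_fps_intr x n : coef (fps_intr x) n = (coef x n)%:~R.
Proof. by []. Qed.

Lemma fps_intrM x y : fps_intr (x * y) = fps_intr x * fps_intr y.
Proof.
apply/fpsP => n; rewrite coef_fps_intr !fps_coefM rmorph_sum /=.
by apply: eq_bigr => i _; rewrite rmorphM.
Qed.

Lemma fps_intrB x y : fps_intr (x - y) = fps_intr x - fps_intr y.
Proof. by apply/fpsP => n; rewrite coef_fps_intr !fps_coefB rmorphB. Qed.

Lemma fps_intr1 : fps_intr 1 = 1.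
Proof. by apply/fpsP => n; rewrite coef_fps_intr !fps_coef1; case: eqP. Qed.

Lemma fps_intr_nat n : fps_intr n%:R = n%:R.
Proof.
by apply/fpsP => m; rewrite coef_fps_intr !coef_natr rmorph_nat.
Qed.

Lemma fps_intrXn n : fps_intr (q ^+ n) = fpsX ^+ n.
Proof. by apply/fpsP => m; rewrite coef_fps_intr !coef_fpsXn; case: eqP. Qed.

Lemma fps_intr_prod (I : Type) (r : seq I) (F : I -> fps int) :
  fps_intr (\prod_(i <- r) F i) = \prod_(i <- r) fps_intr (F i).
Proof.
elim: r => [|i r IHr]; last by rewrite !big_cons fps_intrM IHr.
by rewrite !big_nil fps_intr1.
Qed.

Lemma tends1_intr F : tends1 F -> tends1 (fun i => fps_intr (F i)).
Proof. by move=> F1 i j le_ji; rewrite coef_fps_intr F1 //; case: eqP. Qed.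

Lemma fps_intr_infprod F : tends1 F ->
  fps_intr (fps_infprod F) = fps_infprod (fun i => fps_intr (F i)).
Proof.
move=> F1; apply: eqmodXP => n m le_mn.
rewrite (eqmodX_infprod (tends1_intr F1) (leqnn n)) // -fps_intr_prod !coef_fps_intr.
by rewrite (eqmodX_infprod F1 (leqnn n)).
Qed.

Lemma fps_intr_ell k : (0 < k)%N ->
  fps_intr (ell k) = fps_infprod (fun i => 1 - fpsX ^+ (k * i.+1)).
Proof.
move=> k0; rewrite fps_intr_infprod.
  by apply: eq_infprod => i; rewrite fps_intrB fps_intr1 fps_intrXn.
by move=> i j le_ji; rewrite -[q ^+ _]mul1r fps_coefB coef_mulqX ?subr0 //; nia.
Qed.

End IntMap.

Definition norm3 (w : algC) (x : fps int) : fps algC :=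
  fps_intr algC x * twist w (fps_intr algC x) * twist (w ^+ 2) (fps_intr algC x).

Section Norm3.
Variable w : algC.
Hypothesis w_prim : 3.-primitive_root w.

Let w3 : w ^+ 3 = 1. Proof. exact: prim_expr_order. Qed.

Lemma cube_root_sum : w ^+ 2 + w + 1 = 0.
Proof.
have w1 : w - 1 != 0.
  rewrite subr_eq0; apply/eqP => w1.
  by have := prim_order_dvd w_prim 1; rewrite expr1 w1 eqxx.
apply: (mulfI w1); rewrite mulr0; transitivity (w ^+ 3 - 1); first by ring.
by rewrite w3 subrr.
Qed.

Lemma norm3M x y : norm3 w (x * y) = norm3 w x * norm3 w y.
Proof. by rewrite /norm3 fps_intrM !twistM; ring. Qed.

Lemma norm3_1B n : norm3 w (1 - q ^+ n) =
  if (3 %| n)%N then (1 - fpsX ^+ n) ^+ 3 else 1 - fpsX ^+ (3 * n).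
Proof.
rewrite /norm3 fps_intrB fps_intr1 fps_intrXn !twist1B -exprM mulnC exprM.
set z := fpsC (w ^+ n); have -> : fpsC (w ^+ n ^+ 2) = z * z by rewrite expr2 fpsCM.
case: ifP => [/dvdnP[k nE]|n3].
  have -> : z = 1 by rewrite /z nE mulnC exprM w3 expr1n fpsC1.
  by ring.
have z2 : z * z + z + 1 = 0.
  rewrite -fpsC1 -fpsCM -!fpsCD -fpsC0; congr fpsC; rewrite -expr2.
  rewrite -(expr_mod n w3); have : (n %% 3 = 1 \/ n %% 3 = 2)%N by lia.
  case=> ->; first by rewrite expr1 cube_root_sum.
  by transitivity (w ^+ 3 * w + w ^+ 2 + 1); [ring | rewrite w3 mul1r (addrC w) cube_root_sum].
rewrite mulnC exprM; move: (fpsX ^+ n) => y.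
apply/eqP; rewrite -subr_eq0; apply/eqP.
transitivity ((z * z + z + 1) * (- y + z * y * y + y ^+ 3 * (1 - z))); first by ring.
by rewrite z2 mul0r.
Qed.

(** The norm of the factor 1 - q^(k m) is 1 - q^(3 k m) if 3 does not divide m,
    and (1 - q^(k m))^3 if it does; the second factor on the left supplies the
    1 - q^(3 k m) for the multiples m of 3. *)
Lemma norm3_ell k : (0 < k)%N -> ~~ (3 %| k)%N ->
  norm3 w (ell k) * fps_intr algC (ell (9 * k)) = fps_intr algC (ell (3 * k)) ^+ 4.
Proof.
move=> k0 k3.
pose F (i : nat) : fps int := 1 - q ^+ (k * i.+1).
pose B d (i : nat) : fps algC := 1 - fpsX ^+ (d * i.+1).
have F1 : tends1 F.
  by move=> i j le_ji; rewrite /F -[q ^+ _]mul1r fps_coefB coef_mulqX ?subr0 //; nia.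
have iF1 := tends1_intr algC F1.
have NF1 : tends1 (fun i => norm3 w (F i)).
  by apply: tends1M; [apply: tends1M|]; try apply: tends1_twist.
have B1 d : (0 < d)%N -> tends1 (B d).
  move=> d0 i j le_ji; rewrite /B fps_coefB coef_fpsXn fps_coef1.
  have := leq_pmull i.+1 d0.
  by case: (j =P (d * i.+1)%N) => [jE|_]; [lia | rewrite subr0].
have -> : norm3 w (ell k) = fps_infprod (fun i => norm3 w (F i)).
  rewrite /norm3 /ell -/F (fps_intr_infprod algC F1) !twist_infprod //.
  rewrite -!infprodM //; try (exact: tends1_twist).
  by apply: tends1M => //; apply: tends1_twist.
rewrite !fps_intr_ell ?muln_gt0 ?k0 // -/(B (9 * k)%N) -/(B (3 * k)%N).
have b9 : tends1 (B (9 * k)%N) by apply: B1; rewrite muln_gt0.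
have b3 : tends1 (B (3 * k)%N) by apply: B1; rewrite muln_gt0.
have b3c c : tends1 (fun i => B (3 * k)%N (3 * i + c)%N).
  by apply: (@tends1_sub _ (fun i => 3 * i + c)%N) b3 => i; lia.
have b33 : tends1 (fun i => B (3 * k)%N i * B (3 * k)%N i) by apply: tends1M.
have NF3 : tends1 (fun i => \prod_(c < 3) norm3 w (F (3 * i + c)%N)).
  apply: (@tends1_prod _ 3 (fun c i => norm3 w (F (3 * i + c)%N))) => c.
  by apply: (@tends1_sub _ (fun i => 3 * i + c)%N) NF1 => i; lia.
rewrite (infprod_regroup (isT : 0 < 3)%N NF1) -infprodM //.
transitivity (fps_infprod (fun i => \prod_(c < 3) B (3 * k)%N (3 * i + c)%N) *
  fps_infprod (fun i => B (3 * k)%N i * B (3 * k)%N i * B (3 * k)%N i)).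
  rewrite -infprodM; last 2 first.
  - exact: (@tends1_prod _ 3 (fun c i => B (3 * k)%N (3 * i + c)%N)).
  - exact: tends1M.
  apply: eq_infprod => i; rewrite !big_ord_recr !big_ord0 /= !mul1r /F /B !norm3_1B.
  have -> : (3 %| k * (3 * i + 0).+1)%N = false.
    by apply/negbTE; rewrite Euclid_dvdM // negb_or k3; lia.
  have -> : (3 %| k * (3 * i + 1).+1)%N = false.
    by apply/negbTE; rewrite Euclid_dvdM // negb_or k3; lia.
  have -> : (3 %| k * (3 * i + 2).+1)%N by rewrite dvdn_mull //; lia.
  have -> : (k * (3 * i + 2).+1 = 3 * k * i.+1)%N by lia.
  have -> : (9 * k * i.+1 = 3 * k * (3 * i + 2).+1)%N by lia.
  by rewrite !mulnA; ring.
rewrite -(infprod_regroup (isT : 0 < 3)%N b3) !infprodM //.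
by ring.
Qed.

End Norm3.

Lemma fps_intr_inj (R : numDomainType) : injective (fps_intr R).
Proof.
move=> x y /fpsP xy; apply/fpsP => n; have := xy n.
by rewrite !coef_fps_intr => /intr_inj.
Qed.

Lemma twist_dil3 (R : comNzRingType) (w : R) x : w ^+ 3 = 1 ->
  twist w (fps_intr R (dil 3 x)) = fps_intr R (dil 3 x).
Proof.
move=> w3; apply/fpsP => n; rewrite coef_twist coef_fps_intr coef_dil.
by case: ifP => [/dvdnP[k ->]|_]; rewrite ?mulr0 // mulnC exprM w3 expr1n mul1r.
Qed.

Lemma dil_phi m k : (0 < m)%N -> dil m (phi k) = phi (m * k).
Proof.
move=> m0; rewrite dil_sum; apply: eq_fps_sum => z.
by rewrite sgnz_int dil_intM dil_qpow // PoszM mulrA.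
Qed.

(** The product of the three conjugates of phi(q) = phi(q^9) - 2 q b(q^3), with
    q replaced by w q, can be read on this dissection and on the product. *)
Lemma phi_cubic_norm :
  (phi 9 ^+ 3 - 8 * q ^+ 3 * dil 3 cubic_phi ^+ 3) * phi 9 = phi 3 ^+ 4.
Proof.
have aux (n1 n2 n3 x3 x6 x9 x18 y3 y9 : fps algC) :
    x6 \is a GRing.unit -> x9 \is a GRing.unit ->
    n2 * x9 = x3 ^+ 4 -> n3 * x18 = x6 ^+ 4 -> y3 * x6 = x3 * x3 ->
    y9 * x18 = x9 * x9 -> n1 * n3 = n2 * n2 -> n1 * y9 = y3 ^+ 4.
  move=> u6 u9 e1 e2 p3 p9 np.
  apply: (mulIr (unitrX 4 u6)); apply: (mulIr (unitrX 2 u9)).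
  transitivity ((n1 * n3) * (y9 * x18) * x9 ^+ 2); first by rewrite -e2; ring.
  rewrite np p9; transitivity ((n2 * x9) ^+ 2 * x9 ^+ 2); first by ring.
  rewrite e1; transitivity ((x3 * x3) ^+ 4 * x9 ^+ 2); first by ring.
  by rewrite -p3; ring.
have [w w_prim] := C_prim_root_exists (isT : 0 < 3)%N.
have w3 : w ^+ 3 = 1 := prim_expr_order w_prim.
pose f := fps_intr algC.
have fM x y : f (x * y) = f x * f y := fps_intrM algC x y.
have fX x n : f (x ^+ n) = f x ^+ n.
  by elim: n => [|n IHn]; rewrite ?expr0 ?exprS ?fM ?IHn // /f fps_intr1.
have normE : norm3 w (phi 1) = f (phi 9 ^+ 3 - 8 * q ^+ 3 * dil 3 cubic_phi ^+ 3).
  pose c := fpsC w.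
  have c3 : c * c + c + 1 = 0.
    by rewrite -fpsC1 -fpsCM -!fpsCD -fpsC0 -expr2 cube_root_sum.
  have f9 : twist w (f (phi 9)) = f (phi 9).
    by rewrite -(@dil_phi 3 3) // twist_dil3.
  have f9' : twist (w ^+ 2) (f (phi 9)) = f (phi 9).
    by rewrite -(@dil_phi 3 3) // twist_dil3 // exprAC w3 expr1n.
  have phi1 : f (phi 1) = f (phi 9) - 2 * (fpsX * f (dil 3 cubic_phi)).
    rewrite phi_dissect /f fps_intrB -mulrA 2!fps_intrM (fps_intr_nat _ 2).
    by rewrite -[q in LHS]expr1 fps_intrXn expr1.
  have tw v : twist v (2 * (fpsX * f (dil 3 cubic_phi))) =
      2 * (fpsC v * fpsX * twist v (f (dil 3 cubic_phi))).
    by rewrite twistM twist_nat twistM twistX.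
  rewrite /norm3 -/f phi1 !twistB !tw f9 f9' !twist_dil3 //; last first.
    by rewrite exprAC w3 expr1n.
  have -> : f (phi 9 ^+ 3 - 8 * q ^+ 3 * dil 3 cubic_phi ^+ 3) =
      f (phi 9) ^+ 3 - 8 * fpsX ^+ 3 * f (dil 3 cubic_phi) ^+ 3.
    rewrite -!fX /f fps_intrB (fps_intrM _ (8 * q ^+ 3)) (fps_intrM _ 8).
    by rewrite (fps_intr_nat _ 8) fps_intrXn.
  rewrite expr2 fpsCM -/c -[fps_intr algC (dil 3 cubic_phi)]/(f (dil 3 cubic_phi)).
  move: (f (phi 9)) (f (dil 3 cubic_phi)) => a b.
  apply/eqP; rewrite -subr_eq0; apply/eqP; pose y := 2 * (fpsX * b).
  transitivity ((c * c + c + 1) * (- a ^+ 2 * y + a * c * y ^+ 2 + y ^+ 3 * (1 - c))).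
    by rewrite /y; ring.
  by rewrite c3 mul0r.
have e1 := norm3_ell w_prim (isT : 0 < 1)%N isT.
have e2 := norm3_ell w_prim (isT : 0 < 2)%N isT.
have p1 : phi 1 * ell 2 = ell 1 * ell 1 by rewrite -expr2; exact: phi_ell.
have pf m n : (0 < m)%N -> (2 * m)%N = n -> f (phi m) * f (ell n) = f (ell m) * f (ell m).
  by move=> m0 <-; rewrite -fM phi_ell // expr2 fM.
have p3 := pf 3%N 6%N isT erefl; have p9 := pf 9%N 18%N isT erefl.
apply: (@fps_intr_inj algC); rewrite -/f fM -normE.
rewrite fX.
have np : norm3 w (phi 1) * norm3 w (ell 2) = norm3 w (ell 1) * norm3 w (ell 1).
  by rewrite -!norm3M p1.
have u m : (0 < m)%N -> f (ell m) \is a GRing.unit.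
  by move=> m0; rewrite fps_unitE coef_fps_intr coef_ell0 ?unitr1.
exact: (aux _ _ _ _ _ _ _ _ _ (u 6%N isT) (u 9%N isT) e1 e2 p3 p9 np).
Qed.

(** * Extraction of the coefficients *)

Lemma psi_tri : fps_sum (fun r : nat => q ^+ 'C(r.+1, 2)) = psi 1.
Proof. by apply: eq_fps_sum => r; rewrite mul1r tri_nat. Qed.

Lemma dil_psi m k : (0 < m)%N -> dil m (psi k) = psi (m * k).
Proof.
move=> m0; rewrite dil_sum; apply: eq_fps_sum => z.
by rewrite dil_qpow // PoszM mulrA.
Qed.

Lemma dilX m F n : (0 < m)%N -> dil m (F ^+ n) = dil m F ^+ n.
Proof.
move=> m0; elim: n => [|n IHn]; last by rewrite !exprS dilM // IHn.
by rewrite !expr0 -[1]/(qpow 0) dil_qpow // mulr0.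
Qed.

Lemma sect_even_lambda : sect 2 0 lambda * phi 1 = psi 1 * phi 3.
Proof.
have u m : (0 < m)%N -> ell m \is a GRing.unit := @ell_unit m.
have aux (x1 x2 p f : fps int) : x1 \is a GRing.unit -> x2 \is a GRing.unit ->
    p * x1 = x2 ^+ 2 -> f * x2 = x1 ^+ 2 -> p * p * f = x2 ^+ 3.
  move=> u1 u2 pE fE; apply: (mulIr (unitrX 2 u1)); apply: (mulIr u2).
  transitivity ((p * x1) ^+ 2 * (f * x2)); first by ring.
  by rewrite pE fE; ring.
have aux2 (x1 x2 p f E t : fps int) : x1 \is a GRing.unit -> x2 \is a GRing.unit ->
    p * x1 = x2 ^+ 2 -> f * x2 = x1 ^+ 2 -> x1 ^+ 3 * E = x2 ^+ 3 * t ->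
    E * f = p * t.
  move=> u1 u2 pE fE EE; apply: (mulIr (unitrX 3 u1)); apply: (mulIr u2).
  transitivity (x1 ^+ 3 * E * (f * x2)); first by ring.
  rewrite EE fE; transitivity (p * x1 * t * x1 ^+ 2 * x2); last by ring.
  by rewrite pE; ring.
have p1 : psi 1 * ell 1 = ell 2 ^+ 2 by exact: psi_ell.
have f1 : phi 1 * ell 2 = ell 1 ^+ 2 by exact: phi_ell.
have dE : ell 2 = dil 2 (ell 1) by rewrite dil_ell.
apply: (aux2 _ _ _ _ _ _ (u 1%N isT) (u 2%N isT) p1 f1).
have pp : psi 1 * penta = dil 2 (ell 1 * ell 1).
  rewrite penta_ell p1 (@dilM 2 _ _ isT) -dE expr2; exact: erefl.
have d3 : dil 2 (ell 1 ^+ 3) = psi 1 * psi 1 * phi 1.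
  rewrite (aux _ _ _ _ (u 1%N isT) (u 2%N isT) p1 f1).
  rewrite (@dilX 2 _ _ isT) -dE; exact: erefl.
transitivity (sect 2 0 (psi 1 * (fps_sum hecke_term * phi 1))); last first.
  rewrite (even_part_psi_hecke pp) even_part_psi_jac (@jac_ell 2 isT); exact: erefl.
rewrite -(@sect_dilM 2 0 _ _ isT) d3 -hecke_sumE -lambda_hecke psi_tri; congr (sect _ _ _).
by move: (psi 1) (phi 1) lambda => x y z; ring.
Qed.

Lemma phi_unit m : (0 < m)%N -> phi m \is a GRing.unit.
Proof.
move=> m0; have m2 : (0 < 2 * m)%N by rewrite muln_gt0.
have := unitrX 2 (ell_unit m0); rewrite -(phi_ell m0) unitrM.
by case/andP.
Qed.

Lemma jac_psi_phi m : (0 < m)%N -> jac m = psi m * phi m ^+ 2.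
Proof.
move=> m0; have m2 : (0 < 2 * m)%N by rewrite muln_gt0.
have aux (x y p f : fps int) : x \is a GRing.unit -> y \is a GRing.unit ->
    p * x = y ^+ 2 -> f * y = x ^+ 2 -> x ^+ 3 = p * f ^+ 2.
  move=> ux uy pE fE; apply: (mulIr ux); apply: (mulIr (unitrX 2 uy)).
  transitivity (p * x * (f * y) ^+ 2); last by ring.
  by rewrite pE fE; ring.
rewrite jac_ell //.
exact: (aux _ _ _ _ (ell_unit m0) (ell_unit m2) (psi_ell m0) (phi_ell m0)).
Qed.

Lemma sect_natM m r n F : sect m r (n%:R * F) = n%:R * sect m r F.
Proof. by rewrite -[n%:R in LHS]mulrz_nat -[n%:R in RHS]mulrz_nat sect_intM. Qed.

Lemma sect31_qX k : (k < 4)%N -> sect 3 1 (q ^+ k) = (k == 1)%:R.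
Proof.
move=> k4; apply/fpsP => n; rewrite coef_sect coef_fpsXn coef_natr.
by congr (_%:R); lia.
Qed.

(** Multiplying by phi(q^3)^4 instead of phi(q) leaves on the left a series in q^3
    times the section; on the right, with a = phi(q^9), A = cubic_psi(q^3) and
    B = cubic_phi(q^3), the exponents 1 mod 3 come from 2 A a B + psi(q^9) a^2,
    which is 3 psi(q^9) a^2 because A B = psi(q^9) a. *)
Lemma sect_six_lambda :
  sect 3 1 (sect 2 0 lambda) * phi 1 ^+ 3 = 3 * (jac 3 * phi 3).
Proof.
have EE := sect_even_lambda; move: (sect 2 0 lambda) EE => E EE.
have aux (a b A c f3 p f : fps int) : (a ^+ 3 - 8 * q ^+ 3 * b ^+ 3) * a = f3 ^+ 4 ->
    f = a - 2 * q * b -> p = A + q * c -> A * b = c * a -> E * f = p * f3 ->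
    f3 ^+ 4 * E = f3 * (a * (A * a ^+ 2)) * q ^+ 0 + 3 * (f3 * (a * (c * a ^+ 2)) * q ^+ 1) +
      6 * (f3 * (a * (c * (a * b))) * q ^+ 2) + 4 * (f3 * (a * (c * b ^+ 2)) * q ^+ 3).
  move=> norm fE pE Ab Ef; rewrite -norm.
  transitivity (E * f * (a ^+ 2 + 2 * q * a * b + 4 * q ^+ 2 * b ^+ 2) * a).
    by rewrite fE; ring.
  rewrite Ef pE; apply/eqP; rewrite -subr_eq0; apply/eqP.
  transitivity ((A * b - c * a) * (f3 * a * q * (2 * a + 4 * q * b))); first by ring.
  by rewrite Ab subrr mul0r.
have Ab : dil 3 cubic_psi * dil 3 cubic_phi = psi 9 * phi 9.
  by rewrite -dilM // cubic_psi_phi dilM // dil_psi // dil_phi.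
have := aux _ _ _ _ _ _ _ phi_cubic_norm phi_dissect psi_dissect Ab EE.
have f3 : phi 3 = dil 3 (phi 1) by rewrite dil_phi.
have f9 : phi 9 = dil 3 (phi 3) by rewrite dil_phi.
have p9 : psi 9 = dil 3 (psi 3) by rewrite dil_psi.
have d4 : phi 3 ^+ 4 = dil 3 (phi 1 ^+ 4) by rewrite dilX // -f3.
have d0 : dil 3 (phi 1 * (phi 3 * (cubic_psi * phi 3 ^+ 2))) =
    phi 3 * (phi 9 * (dil 3 cubic_psi * phi 9 ^+ 2)).
  by rewrite 3!(@dilM 3 _ _ isT) (@dilX 3 _ _ isT) -f3 -f9.
have d1 : dil 3 (phi 1 * (phi 3 * (psi 3 * phi 3 ^+ 2))) =
    phi 3 * (phi 9 * (psi 9 * phi 9 ^+ 2)).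
  by rewrite 3!(@dilM 3 _ _ isT) (@dilX 3 _ _ isT) -f3 -f9 -p9.
have d2 : dil 3 (phi 1 * (phi 3 * (psi 3 * (phi 3 * cubic_phi)))) =
    phi 3 * (phi 9 * (psi 9 * (phi 9 * dil 3 cubic_phi))).
  by rewrite 4!(@dilM 3 _ _ isT) -f3 -f9 -p9.
have d3 : dil 3 (phi 1 * (phi 3 * (psi 3 * cubic_phi ^+ 2))) =
    phi 3 * (phi 9 * (psi 9 * dil 3 cubic_phi ^+ 2)).
  by rewrite 3!(@dilM 3 _ _ isT) (@dilX 3 _ _ isT) -f3 -f9 -p9.
rewrite -d0 -d1 -d2 -d3 d4 => /(congr1 (sect 3 1)).
rewrite !sectD !sect_natM !sect_dilM // !sect31_qX //= !(mulr0, mulr1, addr0, add0r).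
rewrite (jac_psi_phi (isT : 0 < 3)%N); have := phi_unit (isT : 0 < 1)%N.
move: (phi 1) (phi 3) (psi 3) (sect 3 1 E) => x y z t ux tE.
apply: (mulrI ux); transitivity (x ^+ 4 * t); first by ring.
by rewrite tE; ring.
Qed.

Lemma coef_qX_pbar3 e n :
  coef (q ^+ e * overpartition3_gf) n = pbar3 (n%:Z - e%:Z).
Proof.
rewrite coef_fpsXnM; case: ltnP => [lt_ne|le_en].
  by rewrite pbar3_lt0 // subr_lt0 ltz_nat.
by rewrite subzn.
Qed.

Lemma phi_unilateral m : (0 < m)%N -> phi m =
  1 + 2 * fps_sum (fun k : nat => (k != 0%N)%:R * ((-1) ^+ k * q ^+ (m * k ^ 2))).
Proof.
move=> m0; have sp := summable_phi m0.
pose F (k : nat) := (-1) ^+ k * q ^+ (m * k ^ 2) : fps int.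
have FE (z : int) : sgnz z * qpow (m%:Z * z ^+ 2) = F `|z|%N.
  by rewrite /F -(qpow_nat (m * _)); congr (_ * qpow _); rewrite PoszM; lia.
have sF : summable F.
  apply: summable_nat => k n lt_nk; rewrite /F coef_mulqX //.
  by rewrite (leq_trans lt_nk) //; nia.
have sF' : summable (fun k => (k != 0%N)%:R * F k) by apply: summableM.
pose D (k : nat) : fps int := (k == 0%N)%:R.
have sD : summable D by apply: summable_nat => -[|k] n.
have DE : fps_sum D = 1.
  by rewrite (@fps_sum_seq _ _ [:: 0%N]) ?big_seq1 // => -[|k].
have S0 : fps_sum F = 1 + fps_sum (fun k => (k != 0%N)%:R * F k).
  transitivity (fps_sum D + fps_sum (fun k => (k != 0%N)%:R * F k)); last by rewrite DE.
  rewrite -fps_sumD //; apply: eq_fps_sum => -[|k].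
    by rewrite /D /F /= mul0r addr0 mul1r muln0.
  by rewrite /D /= add0r mul1r.
have S1 : fps_sum (fun k => F k.+1) = fps_sum (fun k => (k != 0%N)%:R * F k).
  rewrite [RHS](@fps_sum_inj _ _ S).
  - by apply: eq_fps_sum => k; rewrite /= mul1r.
  - by move=> x y [].
  by case=> [|k] h; [rewrite mul0r | case: (h k)].
transitivity (fps_sum (fun n : nat => F n + F n.+1)).
  rewrite /phi fps_sum_int //; apply: eq_fps_sum => k.
  by rewrite !FE; congr (_ + F _); lia.
rewrite fps_sumD //; last by apply: (@summable_comp _ _ S) sF => x y [].
by rewrite S0 S1; ring.
Qed.

Lemma overpartition3_phi : overpartition3_gf * phi 1 ^+ 3 = 1.
Proof.
have u2 : ell 1 ^+ 2 \is a GRing.unit by rewrite unitrX // ell_unit.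
rewrite -exprMn mulrAC [ell 2 * _]mulrC (@phi_ell 1 isT) divrr // expr1n.
exact: erefl.
Qed.

Lemma sect_six_lambdaE :
  sect 3 1 (sect 2 0 lambda) = 3 * (jac 3 * phi 3 * overpartition3_gf).
Proof.
have gE := overpartition3_phi; have EE := sect_six_lambda.
move: (sect 3 1 _) (phi 1) overpartition3_gf gE EE => x y g gE EE.
transitivity (x * (g * y ^+ 3)); first by rewrite gE mulr1.
by rewrite mulrCA EE; ring.
Qed.

Lemma summable_jac m : (0 < m)%N ->
  summable (fun n : nat => sgnz n * (2 * n%:Z + 1)%:~R * qpow (m%:Z * tri n%:Z)).
Proof.
move=> m0; apply: (@summable_comp _ _ Posz
  (fun z => sgnz z * (2 * z + 1)%:~R * qpow (m%:Z * tri z))).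
  by move=> x y [].
exact: summable_tri.
Qed.

Theorem theorem6p3 (n : nat) :
  P_lambda (6 * n + 2) =
    3 * (\sum_(l \in [set: nat])
           (-1) ^+ l * (2 * l + 1)%N%:Z
             * pbar3 (n%:Z - (3 * l * (l + 1) %/ 2)%N%:Z))
  + 6 * (\sum_(l \in [set: nat]) \sum_(k \in [set k : nat | (1 <= k)%N])
           (-1) ^+ (l + k) * (2 * l + 1)%N%:Z
             * pbar3 (n%:Z - (3 * k ^ 2)%N%:Z - (3 * l * (l + 1) %/ 2)%N%:Z)).
Proof.
have -> : P_lambda (6 * n + 2) = coef (sect 3 1 (sect 2 0 lambda)) n.
  by rewrite !coef_sect /P_lambda; congr coef; lia.
pose g := overpartition3_gf.
pose b (l : nat) := (3 * l * (l + 1) %/ 2)%N.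
pose wj (l : nat) : int := (-1) ^+ l * (2 * l + 1)%N%:Z.
have bE (l : nat) : 3%N%:Z * tri l = (b l)%:Z.
  by rewrite /b; have := triE l; move: (tri l) => t; nia.
have le_b (l : nat) : (l <= b l)%N by have := bE l; have := triE l; nia.
have le_a (k : nat) : (k <= 3 * k ^ 2)%N by nia.
have jE : jac 3 = fps_sum (fun l : nat => (wj l)%:~R * q ^+ b l).
  apply: eq_fps_sum => l; rewrite bE sgnz_int -rmorphM /wj.
  by congr (_%:~R * _); lia.
have sj : summable (fun l : nat => (wj l)%:~R * q ^+ b l : fps int).
  apply: eq_summable (@summable_jac 3 isT) => l; rewrite bE sgnz_int -rmorphM /wj.
  by congr (_%:~R * _); lia.
pose Fk (k : nat) : fps int := (k != 0%N)%:R * ((-1) ^+ k * q ^+ (3 * k ^ 2)).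
have sk : summable Fk.
  apply: summableM; apply: summable_nat => k m lt_mk; rewrite coef_mulqX //.
  by rewrite (leq_trans lt_mk).
have T1 : coef (jac 3 * g) n = \sum_(l \in [set: nat]) wj l * pbar3 (n%:Z - (b l)%:Z).
  rewrite (@fsum_pbar3 n setT wj b) // jE mulrC fps_mulr_sumr //.
  rewrite (@coef_fps_sum_seq _ _ (index_iota 0 n.+1)) ?iota_uniq //.
    rewrite [RHS](eq_bigl xpredT) => [|l]; last exact: in_setT.
    by apply: eq_bigr => l _; rewrite mulrCA coef_intM [g * _]mulrC coef_qX_pbar3.
  move=> l; rewrite mem_index_iota ltnS; apply: contraNT; rewrite -ltnNge => lt_nl.
  rewrite mulrA coef_mulqX //; exact: leq_trans (le_b l).
pose c (l k : nat) : int := (-1) ^+ (l + k) * (2 * l + 1)%N%:Z.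
pose A := [set k : nat | (1 <= k)%N].
have T2 : coef (jac 3 * fps_sum Fk * g) n = \sum_(l \in [set: nat]) \sum_(k \in A)
    c l k * pbar3 (n%:Z - (3 * k ^ 2)%N%:Z - (b l)%:Z).
  rewrite (@fsum2_pbar3 n A c (fun k => 3 * k ^ 2)%N b) // jE fps_sumM //.
  rewrite mulrC fps_mulr_sumr; last exact: (summable_mul sj sk).
  have termE l k : g * ((wj l)%:~R * q ^+ b l * Fk k) =
      (k != 0%N)%:R * ((c l k)%:~R * (q ^+ (3 * k ^ 2 + b l) * g)).
    rewrite /Fk /c /wj (exprD q) (exprD (-1 : int)) !rmorphM !rmorphXn rmorphN1 /=.
    by ring.
  have coefE l k : coef (g * ((wj l)%:~R * q ^+ b l * Fk k)) n =
      if (0 < k)%N then c l k * pbar3 (n%:Z - (3 * k ^ 2)%N%:Z - (b l)%:Z) else 0.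
    rewrite termE; case: k => [|k]; first by rewrite mul0r.
    by rewrite mul1r coef_intM coef_qX_pbar3 PoszD opprD addrA.
  rewrite (@coef_fps_sum_seq _ _
    [seq (l, k) | l <- index_iota 0 n.+1, k <- index_iota 0 n.+1]).
  - rewrite big_allpairs; apply: eq_bigr => l _; rewrite [RHS]big_mkcond.
    apply: eq_bigr => k _; rewrite coefE; congr (if _ then _ else _).
    by apply/idP/idP => [k0|/set_mem]; first exact: mem_set.
  - by apply: allpairs_uniq; rewrite ?iota_uniq // => -[? ?] [? ?].
  move=> [l k]; rewrite coefE => nz; apply: allpairs_f.
    rewrite mem_index_iota ltnS; apply: contraNT nz; rewrite -ltnNge => lt_nl.
    case: ifP => // _; rewrite pbar3_lt0 ?mulr0 //.
    by have := le_b l; move: (b l) (3 * k ^ 2)%N => x y; lia.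
  rewrite mem_index_iota ltnS; apply: contraNT nz; rewrite -ltnNge => lt_nk.
  case: ifP => // _; rewrite pbar3_lt0 ?mulr0 //.
  by have := le_a k; move: (b l) (3 * k ^ 2)%N => x y; lia.
rewrite -T1 -T2 sect_six_lambdaE (@phi_unilateral 3 isT) -/Fk -/g.
rewrite -!coef_intM -fps_coefD; congr (coef _ n).
by rewrite -[3%:~R]/(3%:R) -[6%:~R]/(6%:R); ring.
Qed.
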